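(* Let $u\colon R\to U$ be an epimorphism of associative rings such that $\operatorname{Tor}^R_1(U,U)=0=\operatorname{Tor}^R_2(U,U)$. Then the restrictions of the functors $M\longmapsto\operatorname{Ext}^1_R(K^\bullet,M)$ and $C\longmapsto\operatorname{Tor}^R_1(K^\bullet,C)$ are mutually inverse equivalences between the additive category of $u$-cospecial left $u$-comodules $M$ and the additive category of $u$-special left $u$-contramodules $C$ (both viewed as full subcategories of the category of left $R$-modules).
   Context: Rings are associative and unital, not necessarily commutative. A ring homomorphism $u\colon R\to U$ is a ring epimorphism iff the multiplication map $U\otimes_R U\to U$ is an isomorphism; it is not assumed injective. $K^\bullet$ denotes the two-term complex of $R$-$R$-bimodules $R\xrightarrow{u}U$ with $R$ in cohomological degree $-1$ and $U$ in cohomological degree $0$. For a left $R$-module $B$, $\operatorname{Ext}^n_R(K^\bullet,B)=H^n(\mathbb R\operatorname{Hom}_R(K^\bullet,B))=\operatorname{Hom}_{\mathsf D^{\mathsf b}(R\text{-mod})}(K^\bullet,B[n])$, with the left $R$-module structure induced by the right action of $R$ on $K^\bullet$. For a left $R$-module $A$, $\operatorname{Tor}_n^R(K^\bullet,A)=H^{-n}(K^\bullet\otimes_R^{\mathbb L}A)$, with the left $R$-module structure induced by the left action of $R$ on $K^\bullet$. A left $R$-module $M$ is a (left) $u$-comodule if $U\otimes_R M=0=\operatorname{Tor}^R_1(U,M)$. A left $R$-module $C$ is a (left) $u$-contramodule if $\operatorname{Hom}_R(U,C)=0=\operatorname{Ext}^1_R(U,C)$. A left $R$-module $A$ is $u$-special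 if the natural map $A\to U\otimes_R A$ is surjective. A left $R$-module $B$ is $u$-cospecial if the natural map $\operatorname{Hom}_R(U,B)\to B$ is injective. *)

(* Defs.v *)
From HB Require Import structures.
From mathcomp Require Import all_boot all_order all_algebra.
From mathcomp Require Import generic_quotient ring_quotient.
From mathcomp Require Import boolp classical_sets functions cardinality fsbigop.
From mathcomp Require Import finmap.
Set Implicit Arguments.
Unset Strict Implicit.
Unset Printing Implicit Defensive.
Import Order.TTheory GRing.Theory Num.Theory.
Local Open Scope ring_scope.
Local Open Scope quotient_scope.

Section Submodules.
Variable R : pzRingType.

Record submodule (M : lmodType R) := Submodule {
  smset :> M -> Prop;
  sm0 : smset 0;
  smlin : forall a x y, smset x -> smset y -> smset (a *: x + y) }.

Definition smpred (M : lmodType R) (S : submodule M) : pred M :=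
  fun x => `[< S x >].

Lemma smpred_closed M (S : submodule M) :
  GRing.subsemimod_closed (smpred S).
Proof.
split=> [|a x /asboolP Sx]; last first.
  apply/asboolP; rewrite -[a *: x]addr0; apply: smlin => //; exact: sm0.
split=> [|x y /asboolP Sx /asboolP Sy]; apply/asboolP; first exact: sm0.
by rewrite -[x]scale1r; apply: smlin.
Qed.

HB.instance Definition _ M (S : submodule M) :=
  GRing.isSubmodClosed.Build R M (smpred S) (smpred_closed S).

Definition subm (M : lmodType R) (S : submodule M) := {x : M | smpred S x}.
HB.instance Definition _ M (S : submodule M) := SubChoice.on (subm S).
HB.instance Definition _ M (S : submodule M) :=
  [SubChoice_isSubLmodule of subm S by <:].

Definition quotm (M : lmodType R) (S : submodule M) :=
  Quotient.quot (GRing.ZmodClosed.clone M (smpred S) _).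
HB.instance Definition _ M (S : submodule M) := GRing.Zmodule.on (quotm S).
HB.instance Definition _ M (S : submodule M) := EqQuotient.on (quotm S).

Section QuotientModule.
Variables (M : lmodType R) (S : submodule M).
Implicit Types x y : quotm S.

Lemma quotmP (v w : M) : \pi_(quotm S) v = \pi_(quotm S) w <-> S (v - w).
Proof.
split=> [/eqP|/asboolP vw]; first by rewrite -Quotient.idealrBE => /asboolP.
by apply/eqP; rewrite -Quotient.idealrBE.
Qed.

Definition qproj (v : M) : quotm S := \pi_(quotm S) v.
Definition qscale (a : R) x : quotm S := qproj (a *: repr x).

Lemma qscaleE a v : qscale a (qproj v) = qproj (a *: v).
Proof.
apply/quotmP; rewrite -scalerBr -[a *: _]addr0; apply: smlin (sm0 S).
by apply/quotmP; rewrite reprK.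
Qed.

Lemma qprojD v w : qproj (v + w) = qproj v + qproj w.
Proof. exact: (raddfD (\pi_(quotm S))). Qed.

Lemma qprojW (P : quotm S -> Prop) : (forall v, P (qproj v)) -> forall x, P x.
Proof. by move=> Pv x; rewrite -[x]reprK; apply: Pv. Qed.

Lemma qscaleA a b x : qscale a (qscale b x) = qscale (a * b) x.
Proof. by elim/qprojW: x => v; rewrite !qscaleE scalerA. Qed.

Lemma qscale1 : left_id 1 qscale.
Proof. by elim/qprojW=> v; rewrite qscaleE scale1r. Qed.

Lemma qscaleDr : right_distributive qscale +%R.
Proof.
move=> a; elim/qprojW=> v; elim/qprojW=> w.
by rewrite -qprojD !qscaleE scalerDr qprojD.
Qed.

Lemma qscaleDl x : {morph qscale^~ x : a b / a + b}.
Proof.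
by elim/qprojW: x => v a b; rewrite !qscaleE scalerDl qprojD.
Qed.

HB.instance Definition _ := GRing.Zmodule_isLmodule.Build R (quotm S)
  qscaleA qscale1 qscaleDr qscaleDl.

Lemma qproj_linear : linear qproj.
Proof. by move=> a v w; rewrite qprojD -qscaleE. Qed.
HB.instance Definition _ := GRing.isLinear.Build R M (quotm S) _ qproj
  qproj_linear.

End QuotientModule.

Definition mklin (A B : lmodType R) (f : A -> B) (fl : linear f) :
  {linear A -> B} := HB.pack f (GRing.isLinear.Build R A B *:%R f fl).

Lemma lin_ext (A B : lmodType R) (f g : {linear A -> B}) : f =1 g -> f = g.
Proof.
case: f g => [f [[f1] [f2]]] [g [[g1] [g2]]] /= /funext fg.
move: f1 f2 g1 g2; rewrite fg => f1 f2 g1 g2.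
by rewrite (Prop_irrelevance f1 g1) (Prop_irrelevance f2 g2).
Qed.

Section Maps.
Variables (A B : lmodType R) (S : submodule A) (T : submodule B).
Variables (f : {linear A -> B}) (fST : forall x, S x -> T (f x)).

Lemma subm_map_subproof (x : subm S) : smpred T (f (val x)).
Proof. by apply/asboolP; apply: fST; move: (valP x) => /asboolP. Qed.

Definition subm_mapf (x : subm S) : subm T :=
  exist (fun y => smpred T y) (f (val x)) (subm_map_subproof x).

Lemma subm_map_linear : linear subm_mapf.
Proof. by move=> a x y; apply: val_inj; rewrite /= !linearP. Qed.

Definition subm_map : {linear subm S -> subm T} := mklin subm_map_linear.

Definition quotm_mapf (x : quotm S) : quotm T := qproj T (f (repr x)).

Lemma quotm_mapE v : quotm_mapf (qproj S v) = qproj T (f v).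
Proof.
by apply/quotmP; rewrite -linearB; apply/fST/quotmP; rewrite reprK.
Qed.

Lemma quotm_map_linear : linear quotm_mapf.
Proof.
move=> a; elim/qprojW=> x; elim/qprojW=> y.
by rewrite -linearP !quotm_mapE !linearP.
Qed.

Definition quotm_map : {linear quotm S -> quotm T} := mklin quotm_map_linear.

Lemma quotm_map_qproj v : quotm_map (qproj S v) = qproj T (f v).
Proof. exact: quotm_mapE. Qed.
End Maps.

Section QuotLift.
Variables (A B : lmodType R) (S : submodule A).
Variables (f : {linear A -> B}) (fS : forall x, S x -> f x = 0).

Definition quotm_liftf (x : quotm S) : B := f (repr x).

Lemma quotm_liftE v : quotm_liftf (qproj S v) = f v.
Proof.
by apply/eqP; rewrite -subr_eq0 -linearB; apply/eqP/fS/quotmP; rewrite reprK.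
Qed.

Lemma quotm_lift_linear : linear quotm_liftf.
Proof.
move=> a; elim/qprojW=> x; elim/qprojW=> y.
by rewrite -linearP !quotm_liftE linearP.
Qed.

Definition quotm_lift : {linear quotm S -> B} := mklin quotm_lift_linear.

Lemma quotm_lift_qproj v : quotm_lift (qproj S v) = f v.
Proof. exact: quotm_liftE. Qed.
End QuotLift.

Section KernelImage.
Variables (A B : lmodType R) (f : {linear A -> B}).

Lemma lker_lin a x y : f x = 0 -> f y = 0 -> f (a *: x + y) = 0.
Proof. by move=> fx fy; rewrite linearP fx fy scaler0 addr0. Qed.
Definition lker : submodule A := Submodule (linear0 f) lker_lin.

Lemma limg0 : exists x, f x = 0.
Proof. by exists 0; rewrite linear0. Qed.
Lemma limg_lin a y z :
  (exists x, f x = y) -> (exists x, f x = z) -> exists x, f x = a *: y + z.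
Proof. by move=> [v <-] [w <-]; exists (a *: v + w); rewrite linearP. Qed.
Definition limg : submodule B := Submodule limg0 limg_lin.
End KernelImage.

Section Span.
Variables (M : lmodType R) (P : M -> Prop).
Let inspan x := forall S : submodule M, (forall y, P y -> S y) -> S x.
Lemma span0 : inspan 0. Proof. by move=> S _; exact: sm0. Qed.
Lemma span_lin a x y : inspan x -> inspan y -> inspan (a *: x + y).
Proof. by move=> Px Py S PS; apply: smlin; [apply: Px | apply: Py]. Qed.
Definition span : submodule M := Submodule span0 span_lin.
Lemma span_gen x : P x -> span x.
Proof. by move=> Px S; apply. Qed.
End Span.

(* ker g / (ker g :&: im f) *)
Section Homology.
Variables (A B C : lmodType R) (f : {linear A -> B}) (g : {linear B -> C}).

Lemma bnd0 : exists x, f x = val (0 : subm (lker g)).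
Proof. exact: (sm0 (limg f)). Qed.
Lemma bnd_lin a (y z : subm (lker g)) :
  (exists x, f x = val y) -> (exists x, f x = val z) ->
  exists x, f x = val (a *: y + z).
Proof. exact: (@smlin _ (limg f) a). Qed.
Definition boundary : submodule (subm (lker g)) := Submodule bnd0 bnd_lin.
Definition homology : lmodType R := quotm boundary.
End Homology.

Section HomologyMap.
Variables (A B C A' B' C' : lmodType R).
Variables (f : {linear A -> B}) (g : {linear B -> C}).
Variables (f' : {linear A' -> B'}) (g' : {linear B' -> C'}).
Variables (a : {linear A -> A'}) (b : {linear B -> B'}) (c : {linear C -> C'}).
Hypothesis abf : forall x, b (f x) = f' (a x).
Hypothesis bcg : forall x, c (g x) = g' (b x).

Lemma cycle_map_subproof x : lker g x -> lker g' (b x).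
Proof. by rewrite /= -bcg => ->; rewrite linear0. Qed.

Definition cycle_map := subm_map cycle_map_subproof.

Lemma homology_map_subproof x : boundary f g x -> boundary f' g' (cycle_map x).
Proof. by move=> [y fy]; exists (a y); rewrite /= -abf fy. Qed.

Definition homology_map : {linear homology f g -> homology f' g'} :=
  quotm_map homology_map_subproof.

Lemma homology_map_qproj x :
  homology_map (qproj (boundary f g) x) = qproj (boundary f' g') (cycle_map x).
Proof. exact: quotm_map_qproj. Qed.
End HomologyMap.
End Submodules.

Record endofunctor (R : pzRingType) := Endofunctor {
  fobj :> lmodType R -> lmodType R;
  fmap : forall A B : lmodType R, {linear A -> B} -> {linear fobj A -> fobj B};
  fmap_id : forall (A : lmodType R) (x : fobj A), fmap idfun x = x;
  fmap_comp : forall (A B C : lmodType R) (g : {linear B -> C})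
    (f : {linear A -> B}) (x : fobj A), fmap (g \o f) x = fmap g (fmap f x) }.

Section FunctorIteration.
Variable R : pzRingType.

Program Definition fidentity : endofunctor R :=
  @Endofunctor R (fun A => A) (fun A B f => f) _ _.

Lemma fcompose_id (G F : endofunctor R) (A : lmodType R) (x : G (F A)) :
  fmap G (fmap F idfun) x = x.
Proof.
have -> : fmap F (idfun : {linear A -> A}) = idfun; last exact: fmap_id.
by apply: lin_ext => y; exact: fmap_id.
Qed.

Lemma fcompose_comp (G F : endofunctor R) (A B C : lmodType R)
  (g : {linear B -> C}) (f : {linear A -> B}) (x : G (F A)) :
  fmap G (fmap F (g \o f)) x = fmap G (fmap F g) (fmap G (fmap F f) x).
Proof.
rewrite -fmap_comp; congr (fmap G _ x); apply: lin_ext => y; exact: fmap_comp.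
Qed.

Definition fcompose (G F : endofunctor R) : endofunctor R :=
  @Endofunctor R (fun A => G (F A)) (fun A B f => fmap G (fmap F f))
    (@fcompose_id G F) (@fcompose_comp G F).

Fixpoint fiter (F : endofunctor R) (n : nat) : endofunctor R :=
  if n is m.+1 then fcompose F (fiter F m) else fidentity.
End FunctorIteration.

Section Complexes.
Variable R : pzRingType.

Record chain := Chain {
  chob :> nat -> lmodType R;
  chd : forall n, {linear chob n.+1 -> chob n};
  chdd : forall n x, chd n (chd n.+1 x) = 0 }.

Record chmap (C D : chain) := ChMap {
  chmapf :> forall n, {linear C n -> D n};
  chmapd : forall n x, chmapf n (chd C n x) = chd D n (chmapf n.+1 x) }.

Record cochain := Cochain {
  coob :> nat -> lmodType R;
  cod : forall n, {linear coob n -> coob n.+1};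
  codd : forall n x, cod n.+1 (cod n x) = 0 }.

Record comap (C D : cochain) := CoMap {
  comapf :> forall n, {linear C n -> D n};
  comapd : forall n x, comapf n.+1 (cod C n x) = cod D n (comapf n x) }.

Arguments chd : clear implicits.
Arguments cod : clear implicits.
Arguments chdd : clear implicits.
Arguments codd : clear implicits.
Arguments chmapd {C D} c n x.
Arguments comapd {C D} c n x.

Definition lzero (A B : lmodType R) : {linear A -> B} := \0.

(* A chain or cochain complex indexed by nat is zero in negative degrees. *)
Definition chH (C : chain) (n : nat) : lmodType R :=
  match n with
  | 0 => homology (chd C 0) (lzero (C 0) (C 0))
  | m.+1 => homology (chd C m.+1) (chd C m)
  end.

Definition coH (C : cochain) (n : nat) : lmodType R :=
  match n with
  | 0 => homology (lzero (C 0) (C 0)) (cod C 0)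
  | m.+1 => homology (cod C m) (cod C m.+1)
  end.

Lemma lzeroC (A B A' B' : lmodType R) (f : {linear A -> A'})
  (g : {linear B -> B'}) x : g (lzero A B x) = lzero A' B' (f x).
Proof. exact: linear0. Qed.

Definition chHmap (C D : chain) (f : chmap C D) n : {linear chH C n -> chH D n} :=
  match n return {linear chH C n -> chH D n} with
  | 0 => homology_map (chmapd f 0) (lzeroC (f 0) (f 0))
  | m.+1 => homology_map (chmapd f m.+1) (chmapd f m)
  end.

Definition coHmap (C D : cochain) (f : comap C D) n :
  {linear coH C n -> coH D n} :=
  match n return {linear coH C n -> coH D n} with
  | 0 => homology_map (lzeroC (f 0) (f 0)) (comapd f 0)
  | m.+1 => homology_map (comapd f m) (comapd f m.+1)
  end.
Lemma homology_map_id (A B C : lmodType R) (f : {linear A -> B})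
    (g : {linear B -> C}) (a : {linear A -> A}) (b : {linear B -> B})
    (c : {linear C -> C}) abf bcg : b =1 id ->
  @homology_map R A B C A B C f g f g a b c abf bcg =1 id.
Proof.
move=> bE; elim/qprojW=> x; rewrite homology_map_qproj; congr qproj.
by apply: val_inj; rewrite /= bE.
Qed.

Lemma homology_map_comp (A B C A' B' C' A'' B'' C'' : lmodType R)
    (f : {linear A -> B}) (g : {linear B -> C})
    (f' : {linear A' -> B'}) (g' : {linear B' -> C'})
    (f'' : {linear A'' -> B''}) (g'' : {linear B'' -> C''})
    (a : {linear A -> A'}) (b : {linear B -> B'}) (c : {linear C -> C'})
    (a' : {linear A' -> A''}) (b' : {linear B' -> B''}) (c' : {linear C' -> C''})
    (a'' : {linear A -> A''}) (b'' : {linear B -> B''}) (c'' : {linear C -> C''})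
    abf bcg abf' bcg' abf'' bcg'' :
  b'' =1 b' \o b ->
  @homology_map R _ _ _ _ _ _ f g f'' g'' a'' b'' c'' abf'' bcg'' =1
  @homology_map R _ _ _ _ _ _ f' g' f'' g'' a' b' c' abf' bcg' \o
  @homology_map R _ _ _ _ _ _ f g f' g' a b c abf bcg.
Proof.
move=> bE; elim/qprojW=> x; rewrite [RHS]/comp !homology_map_qproj; congr qproj.
by apply: val_inj; rewrite /= bE.
Qed.

Lemma chHmap_id (C : chain) (f : chmap C C) n :
  (forall n, f n =1 id) -> chHmap f n =1 id.
Proof. by move=> fE; case: n => [|n]; apply: homology_map_id. Qed.

Lemma chHmap_comp (C D E : chain) (f : chmap C D) (g : chmap D E)
    (h : chmap C E) n : (forall n, h n =1 g n \o f n) ->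
  chHmap h n =1 chHmap g n \o chHmap f n.
Proof. by move=> hE; case: n => [|n]; apply: homology_map_comp. Qed.

Lemma coHmap_id (C : cochain) (f : comap C C) n :
  (forall n, f n =1 id) -> coHmap f n =1 id.
Proof. by move=> fE; case: n => [|n]; apply: homology_map_id. Qed.

Lemma coHmap_comp (C D E : cochain) (f : comap C D) (g : comap D E)
    (h : comap C E) n : (forall n, h n =1 g n \o f n) ->
  coHmap h n =1 coHmap g n \o coHmap f n.
Proof. by move=> hE; case: n => [|n]; apply: homology_map_comp. Qed.
End Complexes.

Section Cones.
Variable R : pzRingType.

Section PairMaps.
Variables A B C E : lmodType R.

Lemma sum_map_linear (d : {linear A -> B}) (f : {linear C -> B}) :
  linear (fun p : A * C => d p.1 + f p.2).
Proof. by move=> a x y /=; rewrite !linearP scalerDr addrACA. Qed.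
Definition sum_map d f : {linear (A * C)%type -> B} :=
  mklin (sum_map_linear d f).

Lemma pair_map_linear (f : {linear A -> B}) (g : {linear A -> C}) :
  linear (fun x : A => (f x, g x)).
Proof. by move=> a x y; rewrite !linearP. Qed.
Definition pair_map f g : {linear A -> (B * C)%type} :=
  mklin (pair_map_linear f g).

Lemma prod_map_linear (f : {linear A -> B}) (g : {linear C -> E}) :
  linear (fun p : A * C => (f p.1, g p.2)).
Proof. by move=> a x y; rewrite !linearP. Qed.
Definition prod_map f g : {linear (A * C)%type -> (B * E)%type} :=
  mklin (prod_map_linear f g).
End PairMaps.

Section ConeDifferentials.
Variables A B C E : lmodType R.

Lemma cone_step_linear (d : {linear A -> B}) (f : {linear C -> B})
  (e : {linear C -> E}) : linear (fun p : A * C => (d p.1 + f p.2, - e p.2)).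
Proof.
move=> a x y; apply: injective_projections; rewrite /= !linearP //.
by rewrite scalerDr addrACA.
Qed.
Definition cone_step d f e : {linear (A * C)%type -> (B * E)%type} :=
  mklin (cone_step_linear d f e).

Lemma cocone_step_linear (d : {linear A -> B}) (f : {linear A -> E})
  (e : {linear C -> E}) : linear (fun p : A * C => (d p.1, f p.1 - e p.2)).
Proof.
move=> a x y; apply: injective_projections; rewrite /= !linearP //.
by rewrite scalerDr addrACA.
Qed.
Definition cocone_step d f e : {linear (A * C)%type -> (B * E)%type} :=
  mklin (cocone_step_linear d f e).
End ConeDifferentials.

Section Cone.
Variables (C D : chain R) (f : chmap C D).

Definition cone_ob (n : nat) : lmodType R :=
  if n is m.+1 then ((D m.+1 * C m)%type : lmodType R) else D 0.

Definition cone_d (n : nat) : {linear cone_ob n.+1 -> cone_ob n} :=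
  match n return {linear cone_ob n.+1 -> cone_ob n} with
  | 0 => sum_map (chd D 0) (f 0)
  | m.+1 => cone_step (chd D m.+1) (f m.+1) (chd C m)
  end.

Lemma cone_dd n x : cone_d n (cone_d n.+1 x) = 0.
Proof.
case: n x => [|n] x /=.
  by rewrite linearD chdd add0r linearN chmapd subrr.
congr pair; first by rewrite linearD !chdd add0r linearN chmapd subrr.
by rewrite linearN chdd !oppr0.
Qed.

Definition cone : chain R := Chain cone_dd.
End Cone.

Section ConeMap.
Variables (C D C' D' : chain R) (f : chmap C D) (f' : chmap C' D').
Variables (a : chmap C C') (b : chmap D D').
Hypothesis abf : forall n x, b n (f n x) = f' n (a n x).

Definition cone_mapf n : {linear cone f n -> cone f' n} :=
  match n return {linear cone f n -> cone f' n} with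
  | 0 => b 0
  | m.+1 => prod_map (b m.+1) (a m)
  end.

Lemma cone_mapd n x :
  cone_mapf n (chd (cone f) n x) = chd (cone f') n (cone_mapf n.+1 x).
Proof.
case: n x => [|n] x /=; rewrite linearD chmapd abf //.
by rewrite linearN chmapd.
Qed.

Definition cone_map : chmap (cone f) (cone f') := ChMap cone_mapd.
End ConeMap.

Section Cocone.
Variables (D C : cochain R) (f : comap D C).

Definition cocone_ob (n : nat) : lmodType R :=
  if n is m.+1 then ((D m.+1 * C m)%type : lmodType R) else D 0.

Definition cocone_d (n : nat) : {linear cocone_ob n -> cocone_ob n.+1} :=
  match n return {linear cocone_ob n -> cocone_ob n.+1} with
  | 0 => pair_map (cod D 0) (f 0)
  | m.+1 => cocone_step (cod D m.+1) (f m.+1) (cod C m)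
  end.

Lemma cocone_dd n x : cocone_d n.+1 (cocone_d n x) = 0.
Proof.
case: n x => [|n] x /=; congr pair; rewrite ?codd ?comapd ?subrr //.
by rewrite linearB codd subr0 subrr.
Qed.

Definition cocone : cochain R := Cochain cocone_dd.
End Cocone.

Section CoconeMap.
Variables (C D C' D' : cochain R) (f : comap D C) (f' : comap D' C').
Variables (a : comap C C') (b : comap D D').
Hypothesis abf : forall n x, a n (f n x) = f' n (b n x).

Definition cocone_mapf n : {linear cocone f n -> cocone f' n} :=
  match n return {linear cocone f n -> cocone f' n} with
  | 0 => b 0
  | m.+1 => prod_map (b m.+1) (a m)
  end.

Lemma cocone_mapd n x :
  cocone_mapf n.+1 (cod (cocone f) n x) =
  cod (cocone f') n (cocone_mapf n x).
Proof.
case: n x => [|n] x /=; first by rewrite comapd abf.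
by rewrite comapd linearB abf comapd.
Qed.

Definition cocone_map : comap (cocone f) (cocone f') := CoMap cocone_mapd.
End CoconeMap.
End Cones.

Section FreeModule.
Local Open Scope classical_set_scope.
Variables (R : pzRingType) (T : choiceType).

Definition supp (f : T -> R^o) : set T := [set t | f t != 0].

Lemma finsupp0 : finite_set (supp 0).
Proof.
by apply: (@sub_finite_set _ _ set0) => // t; rewrite /supp /= eqxx.
Qed.

Lemma supp_lin (a : R) (f g : T -> R^o) :
  supp (a *: f + g) `<=` supp f `|` supp g.
Proof.
move=> t; rewrite /supp /=; have [f0 | ] := eqVneq (f t) 0; last by left.
have [g0 | ] := eqVneq (g t) 0; last by right.
by rewrite /GRing.add /= /GRing.scale /= f0 g0 scaler0 addr0 eqxx.
Qed.

Lemma finsupp_lin (a : R) (f g : T -> R^o) :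
  finite_set (supp f) -> finite_set (supp g) -> finite_set (supp (a *: f + g)).
Proof.
move=> ff fg; apply: sub_finite_set (@supp_lin a f g) _.
by rewrite finite_setU.
Qed.

Definition freem : lmodType R := subm (Submodule finsupp0 finsupp_lin).

Lemma freem_fin (f : freem) : finite_set (supp (val f)).
Proof. by move: (valP f) => /asboolP. Qed.

Lemma deltam_fin t : finite_set (supp (fun x => (x == t)%:R)).
Proof.
apply: sub_finite_set (finite_set1 t) => x; rewrite /supp /=.
by have [//|] := eqVneq x t; rewrite eqxx.
Qed.

Definition deltam (t : T) : freem :=
  exist (fun f => smpred (Submodule finsupp0 finsupp_lin) f)
    (fun x => (x == t)%:R) (asboolT (deltam_fin t)).

Section Lift.
Variables (M : lmodType R) (h : T -> M).

Definition freem_liftf (f : freem) : M := \sum_(t \in setT) (val f t : R) *: h t.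

Lemma freem_liftE (D : set T) (f : freem) : supp (val f) `<=` D ->
  freem_liftf f = \sum_(t \in D) (val f t : R) *: h t.
Proof.
move=> fD; symmetry; apply: fsbig_widen => // t [_ nDt] /=.
have [-> | ft] := eqVneq (val f t) 0; first exact: scale0r.
by case: nDt; apply: fD.
Qed.

Lemma freem_lift_linear : linear freem_liftf.
Proof.
move=> a f g; have D : finite_set (supp (val f) `|` supp (val g)).
  by rewrite finite_setU; split; exact: freem_fin.
rewrite (@freem_liftE _ (a *: f + g) (@supp_lin a (val f) (val g))).
rewrite (@freem_liftE (supp (val f) `|` supp (val g)) f); last by left.
rewrite (@freem_liftE (supp (val f) `|` supp (val g)) g); last by right.
rewrite !fsbig_finite // scaler_sumr -big_split /=; apply: eq_bigr => t _.
by rewrite scalerDl scalerA.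
Qed.

Definition freem_lift : {linear freem -> M} := mklin freem_lift_linear.

Lemma freem_lift_delta t : freem_lift (deltam t) = h t.
Proof.
rewrite /freem_lift /= (@freem_liftE [set t]) => [|x]; last first.
  by rewrite /supp /=; have [//|] := eqVneq x t; rewrite eqxx.
by rewrite fsbig_set1 /= eqxx scale1r.
Qed.
End Lift.

Lemma freem_lift_sum (M : lmodType R) (h : T -> M) (f : freem) :
  freem_lift h f = \sum_(t <- fset_set (supp (val f))) (val f t : R) *: h t.
Proof.
rewrite /freem_lift /= (freem_liftE h (@subset_refl _ _)) fsbig_finite //.
exact: freem_fin.
Qed.

Lemma val_scale_delta (a : R) (x t : T) :
  val (a *: deltam x) t = a * (t == x)%:R.
Proof. by rewrite linearZ. Qed.

Lemma freemE (f : freem) : f = freem_lift deltam f.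
Proof.
apply: val_inj; rewrite freem_lift_sum.
rewrite raddf_sum; apply/funext => t; rewrite fct_sumE.
have [ft | ft] := eqVneq (val f t) 0.
  rewrite ft big1_seq // => x /andP[_ ]; rewrite in_fset_set; last exact: freem_fin.
  move=> /set_mem; rewrite /supp /= => fx; have [tx | ntx] := eqVneq t x.
    by rewrite -tx ft eqxx in fx.
  apply: etrans (val_scale_delta _ _ _) _; by rewrite (negPf ntx) mulr0.
rewrite (bigD1_seq t) /=; last exact: fset_uniq; last first.
  by rewrite in_fset_set; [apply: mem_set | exact: freem_fin].
rewrite big1 ?addr0 => [|x xt].
  by apply/esym; apply: etrans (val_scale_delta _ _ _) _; rewrite eqxx mulr1.
by apply: etrans (val_scale_delta _ _ _) _; rewrite eq_sym (negPf xt) mulr0.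
Qed.

Lemma freem_ext (M : lmodType R) (f g : freem -> M) : linear f -> linear g ->
  (forall t, f (deltam t) = g (deltam t)) -> f =1 g.
Proof.
move=> fl gl fg x; rewrite -[f]/(mklin fl : _ -> _) -[g]/(mklin gl : _ -> _).
rewrite [x]freemE freem_lift_sum !linear_sum; apply: eq_bigr => t _.
by rewrite !linearZ_LR [mklin fl _]fg.
Qed.
End FreeModule.

Section Syzygies.
Variable R : pzRingType.

Section FreeCover.
Variable A : lmodType R.

Definition free_cover : {linear freem R A -> A} := freem_lift (fun a : A => a).

Lemma free_cover_delta a : free_cover (deltam R a) = a.
Proof. exact: freem_lift_delta. Qed.

Definition syz : lmodType R := subm (lker free_cover).
Definition syz_incl : {linear syz -> freem R A} := val : syz -> freem R A.

Lemma syz_cover (x : syz) : free_cover (syz_incl x) = 0.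
Proof. by move: (valP x) => /asboolP. Qed.
End FreeCover.

Section FreeMap.
Variables (A B : lmodType R) (f : {linear A -> B}).

Definition free_map : {linear freem R A -> freem R B} :=
  freem_lift (fun a => deltam R (f a)).

Lemma free_map_delta a : free_map (deltam R a) = deltam R (f a).
Proof. exact: freem_lift_delta. Qed.

Lemma free_map_cover x : free_cover B (free_map x) = f (free_cover A x).
Proof.
move: x; apply: freem_ext => [a x y|a x y|t]; rewrite ?linearP //.
by rewrite free_map_delta !free_cover_delta.
Qed.

Lemma syz_map_subproof x : lker (free_cover A) x ->
  lker (free_cover B) (free_map x).
Proof.
by move=> Ax; apply: etrans (free_map_cover x) _; rewrite [free_cover A x]Ax linear0.
Qed.

Definition syz_map : {linear syz A -> syz B} := subm_map syz_map_subproof.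
End FreeMap.

Lemma free_map_id (A : lmodType R) (x : freem R A) : free_map idfun x = x.
Proof.
move: x; apply: freem_ext => [a x y|a x y|t]; rewrite ?linearP //.
by rewrite free_map_delta.
Qed.

Lemma free_map_comp (A B C : lmodType R) (g : {linear B -> C})
    (f : {linear A -> B}) (x : freem R A) :
  free_map (g \o f) x = free_map g (free_map f x).
Proof.
move: x; apply: freem_ext => [a x y|a x y|t]; rewrite ?linearP //.
by rewrite !free_map_delta.
Qed.

Lemma syz_map_id (A : lmodType R) (x : syz A) : syz_map idfun x = x.
Proof. by apply: val_inj; exact: free_map_id. Qed.

Lemma syz_map_comp (A B C : lmodType R) (g : {linear B -> C})
    (f : {linear A -> B}) (x : syz A) :
  syz_map (g \o f) x = syz_map g (syz_map f x).
Proof. by apply: val_inj; exact: free_map_comp. Qed.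

Definition syzygy : endofunctor R := Endofunctor syz_map_id syz_map_comp.

Definition free_step (X : lmodType R) : {linear freem R (syz X) -> freem R X} :=
  syz_incl X \o free_cover (syz X).

Lemma free_stepE X x : free_step X x = syz_incl X (free_cover (syz X) x).
Proof. by []. Qed.

Lemma free_step0 X x : free_step X (free_step (syz X) x) = 0.
Proof. by rewrite !free_stepE syz_cover linear0. Qed.

Lemma free_map_incl (X Y : lmodType R) (g : {linear X -> Y}) x :
  free_map g (syz_incl X x) = syz_incl Y (syz_map g x).
Proof. by []. Qed.

Lemma free_step_map (X Y : lmodType R) (g : {linear X -> Y}) x :
  free_map g (free_step X x) = free_step Y (free_map (syz_map g) x).
Proof. by rewrite !free_stepE free_map_incl free_map_cover. Qed.

(* The functorial free resolution
   ... -> R^(Omega (Omega A)) -> R^(Omega A) -> R^(A) of A,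
   where Omega X is the kernel of R^(X) -> X. *)
Definition free_res (A : lmodType R) : chain R :=
  @Chain R (fun n => freem R (fiter syzygy n A))
    (fun n => free_step (fiter syzygy n A)) (fun n => @free_step0 _).

Definition free_res_map (A B : lmodType R) (f : {linear A -> B}) :
  chmap (free_res A) (free_res B) :=
  @ChMap R (free_res A) (free_res B) (fun n => free_map (fmap (fiter syzygy n) f))
    (fun n => @free_step_map _ _ _).

Lemma free_res_map_id (A : lmodType R) n x :
  free_res_map (idfun : {linear A -> A}) n x = x.
Proof.
have E : fmap (fiter syzygy n) (idfun : {linear A -> A}) = idfun.
  by apply: lin_ext => y; exact: fmap_id.
rewrite [LHS](_ : _ = free_map (fmap (fiter syzygy n) idfun) x) // E.
exact: free_map_id.
Qed.

Lemma free_res_map_comp (A B C : lmodType R) (g : {linear B -> C})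
    (f : {linear A -> B}) n x :
  free_res_map (g \o f) n x = free_res_map g n (free_res_map f n x).
Proof.
have E : fmap (fiter syzygy n) (g \o f) =
    fmap (fiter syzygy n) g \o fmap (fiter syzygy n) f.
  by apply: lin_ext => y; exact: fmap_comp.
rewrite [LHS](_ : _ = free_map (fmap (fiter syzygy n) (g \o f)) x) // E.
exact: free_map_comp.
Qed.
End Syzygies.

Section Bimodules.
Variable R : pzRingType.

Record bimodule := Bimodule {
  bimod :> lmodType R;
  ract : bimod -> R -> bimod;
  ractDl : forall x y r, ract (x + y) r = ract x r + ract y r;
  ractDr : forall x r s, ract x (r + s) = ract x r + ract x s;
  ract1 : forall x, ract x 1 = x;
  ractM : forall x r s, ract x (r * s) = ract (ract x r) s;
  ractZ : forall a x r, ract (a *: x) r = a *: ract x r }.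

Record bimap (N N' : bimodule) := Bimap {
  bimapf :> {linear N -> N'};
  bimap_ract : forall x r, bimapf (ract x r) = ract (bimapf x) r }.

Definition bimap_id (N : bimodule) : bimap N N :=
  @Bimap N N idfun (fun x r => erefl).

Lemma ract_linear (N : bimodule) (r : R) : linear (fun x : N => ract x r).
Proof. by move=> a x y; rewrite ractDl ractZ. Qed.

Section Tensor.
Variables (N : bimodule) (A : lmodType R).

Let d (n : N) (a : A) : freem R (N * A)%type := deltam R (n, a).

Inductive tens_rel : freem R (N * A)%type -> Prop :=
| TensDl n n' a : tens_rel (d (n + n') a - d n a - d n' a)
| TensDr n a a' : tens_rel (d n (a + a') - d n a - d n a')
| TensB n r a : tens_rel (d (ract n r) a - d n (r *: a))
| TensZ r n a : tens_rel (d (r *: n) a - r *: d n a).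

(* N (x)_R A as a left R-module. Since r *: (n (x) a) = (r *: n) (x) a, the left
   R-module generated by the n (x) a is also generated by them as a group. *)
Definition tens : lmodType R := quotm (span tens_rel).
Definition ptens (n : N) (a : A) : tens := qproj (span tens_rel) (d n a).

Lemma ptens_rel x : tens_rel x -> qproj (span tens_rel) x = 0.
Proof.
by move=> Rx; rewrite -(linear0 (qproj _)); apply/quotmP; rewrite subr0; apply: span_gen.
Qed.

Lemma ptensDl n n' a : ptens (n + n') a = ptens n a + ptens n' a.
Proof.
move/eqP: (ptens_rel (TensDl n n' a)).
by rewrite !linearB subr_eq0 subr_eq [X in _ == X]addrC => /eqP.
Qed.
Lemma ptensDr n a a' : ptens n (a + a') = ptens n a + ptens n a'.
Proof.
move/eqP: (ptens_rel (TensDr n a a')).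
by rewrite !linearB subr_eq0 subr_eq [X in _ == X]addrC => /eqP.
Qed.
Lemma ptensB n r a : ptens (ract n r) a = ptens n (r *: a).
Proof.
by move/eqP: (ptens_rel (TensB n r a)); rewrite linearB subr_eq0 => /eqP.
Qed.
Lemma ptensZ r n a : ptens (r *: n) a = r *: ptens n a.
Proof.
move/eqP: (ptens_rel (TensZ r n a)).
by rewrite linearB linearZ_LR subr_eq0 => /eqP.
Qed.

Lemma tens_ext (M : lmodType R) (f g : tens -> M) : linear f -> linear g ->
  (forall n a, f (ptens n a) = g (ptens n a)) -> f =1 g.
Proof.
move=> fl gl fg; elim/qprojW=> x; move: x.
apply: (@freem_ext R _ _ (fun x => f (qproj _ x)) (fun x => g (qproj _ x))).
- by move=> a x y; rewrite linearP fl.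
- by move=> a x y; rewrite linearP gl.
- by case=> n a; exact: fg.
Qed.

Section TensorLift.
Variables (M : lmodType R) (b : N -> A -> M).
Hypothesis bDl : forall n n' a, b (n + n') a = b n a + b n' a.
Hypothesis bDr : forall n a a', b n (a + a') = b n a + b n a'.
Hypothesis bB : forall n r a, b (ract n r) a = b n (r *: a).
Hypothesis bZ : forall r n a, b (r *: n) a = r *: b n a.

Let bl : {linear freem R (N * A)%type -> M} := freem_lift (fun p => b p.1 p.2).

Lemma tens_lift_subproof x : span tens_rel x -> bl x = 0.
Proof.
move=> /(_ (lker bl)); apply => {x} x Rx; suff: bl x = 0 by [].
case: Rx => [n n' a | n a a' | n r a | r n a].
- rewrite !linearB; apply/eqP; rewrite subr_eq0 subr_eq [X in _ == X]addrC.
  by apply/eqP; rewrite !freem_lift_delta; exact: bDl.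
- rewrite !linearB; apply/eqP; rewrite subr_eq0 subr_eq [X in _ == X]addrC.
  by apply/eqP; rewrite !freem_lift_delta; exact: bDr.
- rewrite !linearB; apply/eqP; rewrite subr_eq0.
  by apply/eqP; rewrite !freem_lift_delta; exact: bB.
- rewrite linearB linearZ_LR; apply/eqP; rewrite subr_eq0.
  by apply/eqP; rewrite !freem_lift_delta; exact: bZ.
Qed.

Definition tens_lift : {linear tens -> M} := quotm_lift tens_lift_subproof.

Lemma tens_lift_ptens n a : tens_lift (ptens n a) = b n a.
Proof. by rewrite /tens_lift quotm_lift_qproj /bl freem_lift_delta. Qed.
End TensorLift.
End Tensor.
End Bimodules.

Section TensorMap.
Variable R : pzRingType.

Section TensMap.
Variables (N N' : bimodule R) (A A' : lmodType R).
Variables (phi : bimap N N') (f : {linear A -> A'}).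

Let b (n : N) (a : A) : tens N' A' := ptens (phi n) (f a).

Lemma tens_map_Dl n n' a : b (n + n') a = b n a + b n' a.
Proof. by rewrite /b linearD ptensDl. Qed.
Lemma tens_map_Dr n a a' : b n (a + a') = b n a + b n a'.
Proof. by rewrite /b linearD ptensDr. Qed.
Lemma tens_map_B n r a : b (ract n r) a = b n (r *: a).
Proof. by rewrite /b linearZ_LR bimap_ract ptensB. Qed.
Lemma tens_map_Z r n a : b (r *: n) a = r *: b n a.
Proof. by rewrite /b linearZ_LR ptensZ. Qed.

Definition tens_map : {linear tens N A -> tens N' A'} :=
  tens_lift tens_map_Dl tens_map_Dr tens_map_B tens_map_Z.

Lemma tens_map_ptens n a : tens_map (ptens n a) = ptens (phi n) (f a).
Proof. exact: tens_lift_ptens. Qed.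
End TensMap.

Lemma tens_map_id (N : bimodule R) (A : lmodType R) (phi : bimap N N)
    (f : {linear A -> A}) x :
  phi =1 id -> f =1 id -> tens_map phi f x = x.
Proof.
move=> phiE fE; move: x.
apply: tens_ext => [a x y|a x y|n a]; rewrite ?linearP //.
by rewrite tens_map_ptens phiE fE.
Qed.

Lemma tens_map_comp (N N' N'' : bimodule R) (A A' A'' : lmodType R)
    (phi : bimap N N') (f : {linear A -> A'})
    (phi' : bimap N' N'') (f' : {linear A' -> A''})
    (phi'' : bimap N N'') (f'' : {linear A -> A''}) x :
  phi'' =1 phi' \o phi -> f'' =1 f' \o f ->
  tens_map phi'' f'' x = tens_map phi' f' (tens_map phi f x).
Proof.
move=> phiE fE; move: x.
apply: tens_ext => [a x y|a x y|n a]; rewrite ?linearP //.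
by rewrite !tens_map_ptens phiE fE.
Qed.

Lemma tens_map0 (N N' : bimodule R) (A A' : lmodType R) (phi : bimap N N')
    (f : {linear A -> A'}) x : f =1 (fun=> 0) -> tens_map phi f x = 0.
Proof.
move=> fE; move: x.
apply: (@tens_ext _ _ _ _ _ (fun=> 0)) => [a x y|a x y|n a]; rewrite ?linearP //.
  by rewrite scaler0 addr0.
rewrite tens_map_ptens fE; apply: (addrI (ptens (phi n) 0)).
by rewrite -ptensDr !addr0.
Qed.

Section TensChain.
Variables (N : bimodule R) (C : chain R).

Lemma tens_chdd n x :
  tens_map (bimap_id N) (chd C n) (tens_map (bimap_id N) (chd C n.+1) x) = 0.
Proof.
rewrite -(@tens_map_comp _ _ _ _ _ _ _ _ _ _ (bimap_id N) (chd C n \o chd C n.+1)) //.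
by apply: tens_map0 => y; exact: chdd.
Qed.

Definition tens_chain : chain R :=
  @Chain R (fun n => tens N (C n)) (fun n => tens_map (bimap_id N) (chd C n))
    tens_chdd.
End TensChain.

Section TensChainMap.
Variables (N N' : bimodule R) (C C' : chain R).
Variables (phi : bimap N N') (f : chmap C C').

Lemma tens_chmapd n x :
  tens_map phi (f n) (tens_map (bimap_id N) (chd C n) x) =
  tens_map (bimap_id N') (chd C' n) (tens_map phi (f n.+1) x).
Proof.
rewrite -(@tens_map_comp _ _ _ _ _ _ _ _ _ _ phi (f n \o chd C n)) //.
by apply: tens_map_comp => // y; exact: chmapd.
Qed.

Definition tens_chmap : chmap (tens_chain N C) (tens_chain N' C') :=
  @ChMap R (tens_chain N C) (tens_chain N' C') (fun n => tens_map phi (f n))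
    tens_chmapd.
End TensChainMap.
End TensorMap.

Section Hom.
Variable R : pzRingType.

Section HomModule.
Variables (N : bimodule R) (B : lmodType R).

Definition islinear (f : N -> B) : bool := `[< linear f >].

Lemma islinear_zmod_closed : zmod_closed islinear.
Proof.
split=> [|f g /asboolP fl /asboolP gl]; apply/asboolP => a x y /=.
  by rewrite /GRing.zero /= scaler0 addr0.
by rewrite /GRing.add /= /GRing.opp /= fl gl scalerBr opprD addrACA.
Qed.
HB.instance Definition _ :=
  GRing.isZmodClosed.Build (N -> B) islinear islinear_zmod_closed.

Definition homs := {f : N -> B | islinear f}.
HB.instance Definition _ := SubChoice.on homs.
HB.instance Definition _ := [SubChoice_isSubZmodule of homs by <:].

Lemma homs_linear (f : homs) : linear (val f).
Proof. by move: (valP f) => /asboolP. Qed.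

Lemma homs_scale_subproof (a : R) (f : homs) :
  islinear (fun x => val f (ract x a)).
Proof. by apply/asboolP => b x y; rewrite ractDl ractZ homs_linear. Qed.
Definition homs_scale (a : R) (f : homs) : homs :=
  exist islinear _ (homs_scale_subproof a f).

Lemma homs_scaleA a b f : homs_scale a (homs_scale b f) = homs_scale (a * b) f.
Proof. by apply/val_inj/funext => x /=; rewrite ractM. Qed.
Lemma homs_scale1 : left_id 1 homs_scale.
Proof. by move=> f; apply/val_inj/funext => x /=; rewrite ract1. Qed.
Lemma homs_scaleDr : right_distributive homs_scale +%R.
Proof. by move=> a f g; apply/val_inj/funext. Qed.
Lemma homs_scaleDl f : {morph homs_scale^~ f : a b / a + b}.
Proof.
move=> a b; apply/val_inj/funext => x /=; rewrite ractDr.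
by rewrite -[ract x a]scale1r homs_linear scale1r.
Qed.
HB.instance Definition _ := GRing.Zmodule_isLmodule.Build R homs
  homs_scaleA homs_scale1 homs_scaleDr homs_scaleDl.
End HomModule.

Section HomMap.
Variables (N N' : bimodule R) (B B' : lmodType R).
Variables (phi : bimap N' N) (g : {linear B -> B'}).

Lemma homs_map_subproof (f : homs N B) : islinear (fun x => g (val f (phi x))).
Proof. by apply/asboolP => a x y; rewrite linearP homs_linear linearP. Qed.

Definition homs_mapf (f : homs N B) : homs N' B' :=
  exist (@islinear N' B') _ (homs_map_subproof f).

Lemma homs_map_linear : linear homs_mapf.
Proof.
move=> a f h; apply/val_inj/funext => x /=.
by rewrite [LHS]linearD -bimap_ract.
Qed.

Definition homs_map : {linear homs N B -> homs N' B'} := mklin homs_map_linear.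

Lemma homs_mapE f x : val (homs_map f) x = g (val f (phi x)).
Proof. by []. Qed.
End HomMap.

Section HomCochain.
Variables (N : bimodule R) (C : cochain R).

Lemma homs_codd n x :
  homs_map (bimap_id N) (cod C n.+1) (homs_map (bimap_id N) (cod C n) x) = 0.
Proof. by apply/val_inj/funext => y; rewrite !homs_mapE codd. Qed.

Definition homs_cochain : cochain R :=
  @Cochain R (fun n => homs N (C n)) (fun n => homs_map (bimap_id N) (cod C n))
    homs_codd.
End HomCochain.

Section HomCochainMap.
Variables (N N' : bimodule R) (C C' : cochain R).
Variables (phi : bimap N' N) (f : comap C C').

Lemma homs_comapd n x :
  homs_map phi (f n.+1) (homs_map (bimap_id N) (cod C n) x) =
  homs_map (bimap_id N') (cod C' n) (homs_map phi (f n) x).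
Proof. by apply/val_inj/funext => y; rewrite !homs_mapE comapd. Qed.

Definition homs_comap : comap (homs_cochain N C) (homs_cochain N' C') :=
  @CoMap R (homs_cochain N C) (homs_cochain N' C') (fun n => homs_map phi (f n))
    homs_comapd.
End HomCochainMap.
End Hom.

Section RationalsModIntegers.
Definition isint (q : rat) : bool := q \is a Num.int.
Lemma isint_zmod_closed : zmod_closed isint.
Proof. by split=> [|x y]; [exact: rpred0 | exact: rpredB]. Qed.
HB.instance Definition _ := GRing.isZmodClosed.Build rat isint isint_zmod_closed.

Definition QmodZ : zmodType := Quotient.quot (GRing.ZmodClosed.clone rat isint _).
End RationalsModIntegers.

Section Cofree.
Variable R : pzRingType.

Definition charm (B : lmodType R) := {additive B -> QmodZ}.

Lemma charm_ext (B : lmodType R) (f g : charm B) : f =1 g -> f = g.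
Proof.
case: f g => [f [[f1]]] [g [[g1]]] /= /funext fg.
by move: f1 g1; rewrite fg => f1 g1; rewrite (Prop_irrelevance f1 g1).
Qed.

Section CofreeModule.
Variable B : lmodType R.

Definition isadditive (f : R -> charm B -> QmodZ) : bool :=
  `[< forall x y, f (x + y) = f x + f y >].

Lemma isadditive_zmod_closed : zmod_closed isadditive.
Proof.
split=> [|f g /asboolP fl /asboolP gl]; apply/asboolP => x y.
  by rewrite /GRing.zero /= addr0.
by rewrite /GRing.add /= /GRing.opp /= fl gl opprD addrACA.
Qed.
HB.instance Definition _ := GRing.isZmodClosed.Build
  (R -> charm B -> QmodZ) isadditive isadditive_zmod_closed.

(* The injective module Hom_Z(R, (Q/Z)^X), where X = Hom_Z(B, Q/Z), with
   (a f)(x) = f(x a). *)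
Definition cofreem := {f : R -> charm B -> QmodZ | isadditive f}.
HB.instance Definition _ := SubChoice.on cofreem.
HB.instance Definition _ := [SubChoice_isSubZmodule of cofreem by <:].

Lemma cofreemD (f : cofreem) x y : val f (x + y) = val f x + val f y.
Proof. by move: (valP f) => /asboolP. Qed.

Lemma cofreem_scale_subproof (a : R) (f : cofreem) :
  isadditive (fun x => val f (x * a)).
Proof. by apply/asboolP => x y; rewrite mulrDl cofreemD. Qed.
Definition cofreem_scale (a : R) (f : cofreem) : cofreem :=
  exist isadditive _ (cofreem_scale_subproof a f).

Lemma cofreem_scaleA a b f :
  cofreem_scale a (cofreem_scale b f) = cofreem_scale (a * b) f.
Proof. by apply/val_inj/funext => x /=; rewrite mulrA. Qed.
Lemma cofreem_scale1 : left_id 1 cofreem_scale.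
Proof. by move=> f; apply/val_inj/funext => x /=; rewrite mulr1. Qed.
Lemma cofreem_scaleDr : right_distributive cofreem_scale +%R.
Proof. by move=> a f g; apply/val_inj/funext. Qed.
Lemma cofreem_scaleDl f : {morph cofreem_scale^~ f : a b / a + b}.
Proof. by move=> a b; apply/val_inj/funext => x /=; rewrite mulrDr cofreemD. Qed.
HB.instance Definition _ := GRing.Zmodule_isLmodule.Build R cofreem
  cofreem_scaleA cofreem_scale1 cofreem_scaleDr cofreem_scaleDl.

Lemma cofree_unit_subproof (b : B) :
  isadditive (fun x (chi : charm B) => chi (x *: b)).
Proof. by apply/asboolP => x y; apply/funext => chi; rewrite scalerDl raddfD. Qed.
Definition cofree_unitf (b : B) : cofreem :=
  exist isadditive _ (cofree_unit_subproof b).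
Lemma cofree_unit_linear : linear cofree_unitf.
Proof.
move=> a b c; apply/val_inj/funext => x; apply/funext => chi /=.
by rewrite scalerDr raddfD scalerA.
Qed.
Definition cofree_unit : {linear B -> cofreem} := mklin cofree_unit_linear.

Definition cosyz : lmodType R := quotm (limg cofree_unit).
Definition cosyz_proj : {linear cofreem -> cosyz} := qproj (limg cofree_unit).

Lemma cosyz_unit b : cosyz_proj (cofree_unit b) = 0.
Proof.
rewrite -(linear0 cosyz_proj); apply/quotmP; rewrite subr0.
by exists b.
Qed.
End CofreeModule.

Section CofreeMap.
Variables (A B : lmodType R) (g : {linear A -> B}).

Lemma cofree_map_subproof (f : cofreem A) :
  isadditive (fun x (chi : charm B) => val f x (chi \o g : charm A)).
Proof. by apply/asboolP => x y; rewrite cofreemD. Qed.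
Definition cofree_mapf (f : cofreem A) : cofreem B :=
  exist (@isadditive B) _ (cofree_map_subproof f).
Lemma cofree_map_linear : linear cofree_mapf.
Proof. by move=> a f h; apply/val_inj/funext. Qed.
Definition cofree_map : {linear cofreem A -> cofreem B} :=
  mklin cofree_map_linear.

Lemma cofree_map_unit a : cofree_map (cofree_unit A a) = cofree_unit B (g a).
Proof.
by apply/val_inj/funext => x; apply/funext => chi; rewrite /= linearZ_LR.
Qed.

Lemma cosyz_map_subproof x : limg (cofree_unit A) x ->
  limg (cofree_unit B) (cofree_map x).
Proof. by move=> [a <-]; exists (g a); rewrite cofree_map_unit. Qed.

Definition cosyz_map : {linear cosyz A -> cosyz B} := quotm_map cosyz_map_subproof.

Lemma cosyz_map_proj x : cosyz_map (cosyz_proj A x) = cosyz_proj B (cofree_map x).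
Proof. exact: quotm_map_qproj. Qed.
End CofreeMap.

Lemma cofree_map_id (A : lmodType R) (x : cofreem A) : cofree_map idfun x = x.
Proof.
apply/val_inj/funext => r; apply/funext => chi /=.
by congr (val x r _); apply: charm_ext.
Qed.

Lemma cofree_map_comp (A B C : lmodType R) (g : {linear B -> C})
    (f : {linear A -> B}) (x : cofreem A) :
  cofree_map (g \o f) x = cofree_map g (cofree_map f x).
Proof.
apply/val_inj/funext => r; apply/funext => chi /=.
by congr (val x r _); apply: charm_ext.
Qed.

Lemma cosyz_map_id (A : lmodType R) (x : cosyz A) : cosyz_map idfun x = x.
Proof.
by elim/qprojW: x => x; apply: etrans (cosyz_map_proj _ _) _; rewrite cofree_map_id.
Qed.

Lemma cosyz_map_comp (A B C : lmodType R) (g : {linear B -> C})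
    (f : {linear A -> B}) (x : cosyz A) :
  cosyz_map (g \o f) x = cosyz_map g (cosyz_map f x).
Proof.
elim/qprojW: x => x; rewrite -[qproj _ x]/(cosyz_proj A x).
by rewrite !cosyz_map_proj cofree_map_comp.
Qed.

Definition cosyzygy : endofunctor R := Endofunctor cosyz_map_id cosyz_map_comp.

Definition cofree_step (X : lmodType R) : {linear cofreem X -> cofreem (cosyz X)} :=
  cofree_unit (cosyz X) \o cosyz_proj X.

Lemma cofree_stepE X x : cofree_step X x = cofree_unit (cosyz X) (cosyz_proj X x).
Proof. by []. Qed.

Lemma cofree_step0 X x : cofree_step (cosyz X) (cofree_step X x) = 0.
Proof. by rewrite !cofree_stepE cosyz_unit linear0. Qed.

Lemma cofree_step_map (X Y : lmodType R) (g : {linear X -> Y}) x :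
  cofree_map (cosyz_map g) (cofree_step X x) = cofree_step Y (cofree_map g x).
Proof. by rewrite !cofree_stepE cofree_map_unit cosyz_map_proj. Qed.

(* The functorial injective resolution of B: with J X the module cofreem X, the
   unit X -> J X is injective, Sigma X = J X / X, and the terms are
   J B -> J (Sigma B) -> J (Sigma (Sigma B)) -> ... *)
Definition inj_res (B : lmodType R) : cochain R :=
  @Cochain R (fun n => cofreem (fiter cosyzygy n B))
    (fun n => cofree_step (fiter cosyzygy n B)) (fun n => @cofree_step0 _).

Definition inj_res_map (A B : lmodType R) (f : {linear A -> B}) :
  comap (inj_res A) (inj_res B) :=
  @CoMap R (inj_res A) (inj_res B) (fun n => cofree_map (fmap (fiter cosyzygy n) f))
    (fun n => @cofree_step_map _ _ _).

Lemma inj_res_map_id (A : lmodType R) n x :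
  inj_res_map (idfun : {linear A -> A}) n x = x.
Proof.
have E : fmap (fiter cosyzygy n) (idfun : {linear A -> A}) = idfun.
  by apply: lin_ext => y; exact: fmap_id.
rewrite [LHS](_ : _ = cofree_map (fmap (fiter cosyzygy n) idfun) x) // E.
exact: cofree_map_id.
Qed.

Lemma inj_res_map_comp (A B C : lmodType R) (g : {linear B -> C})
    (f : {linear A -> B}) n x :
  inj_res_map (g \o f) n x = inj_res_map g n (inj_res_map f n x).
Proof.
have E : fmap (fiter cosyzygy n) (g \o f) =
    fmap (fiter cosyzygy n) g \o fmap (fiter cosyzygy n) f.
  by apply: lin_ext => y; exact: fmap_comp.
rewrite [LHS](_ : _ = cofree_map (fmap (fiter cosyzygy n) (g \o f)) x) // E.
exact: cofree_map_comp.
Qed.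
End Cofree.

Section Derived.
Variable R : pzRingType.

Definition Tor (N : bimodule R) (n : nat) (A : lmodType R) : lmodType R :=
  chH (tens_chain N (free_res A)) n.

Definition Ext (N : bimodule R) (n : nat) (B : lmodType R) : lmodType R :=
  coH (homs_cochain N (inj_res B)) n.

Definition chmap_id (C : chain R) : chmap C C :=
  @ChMap R C C (fun n => idfun) (fun n x => erefl).
Definition comap_id (C : cochain R) : comap C C :=
  @CoMap R C C (fun n => idfun) (fun n x => erefl).

(* k is the complex of bimodules K = (N1 -> N0), with N0 in cohomological
   degree 0 and N1 in degree -1. *)
Section TwoTerm.
Variables (N1 N0 : bimodule R) (k : bimap N1 N0).

(* K (x)_R F with F = free_res A: its term in cohomological degree -n is
   (N0 (x) F_n) (+) (N1 (x) F_(n-1)). *)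
Definition ltens (A : lmodType R) : chain R :=
  cone (tens_chmap k (chmap_id (free_res A))).

Lemma ltens_map_subproof (A B : lmodType R) (f : {linear A -> B}) n x :
  tens_chmap (bimap_id N0) (free_res_map f) n
    (tens_chmap k (chmap_id (free_res A)) n x) =
  tens_chmap k (chmap_id (free_res B)) n
    (tens_chmap (bimap_id N1) (free_res_map f) n x).
Proof.
rewrite -(@tens_map_comp R _ _ _ _ _ _ k idfun (bimap_id N0)
  (free_res_map f n) k (free_res_map f n)) //.
exact: (@tens_map_comp R _ _ _ _ _ _ (bimap_id N1) _ k idfun).
Qed.

Definition ltens_map (A B : lmodType R) (f : {linear A -> B}) :
  chmap (ltens A) (ltens B) := cone_map (ltens_map_subproof f).

Lemma ltens_map_id (A : lmodType R) n x :
  ltens_map (idfun : {linear A -> A}) n x = x.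
Proof.
have E N m y : tens_map (bimap_id N) (free_res_map (@idfun A) m) y = y.
  by apply: tens_map_id => // z; exact: free_res_map_id.
case: n x => [|n] x; first exact: E.
by apply: injective_projections; exact: E.
Qed.

Lemma ltens_map_comp (A B C : lmodType R) (g : {linear B -> C})
    (f : {linear A -> B}) n x :
  ltens_map (g \o f) n x = ltens_map g n (ltens_map f n x).
Proof.
have E N m y : tens_map (bimap_id N) (free_res_map (g \o f) m) y =
  tens_map (bimap_id N) (free_res_map g m)
    (tens_map (bimap_id N) (free_res_map f m) y).
  by apply: tens_map_comp => // z; exact: free_res_map_comp.
case: n x => [|n] x; first exact: E.
by apply: injective_projections; exact: E.
Qed.

(* A |-> H^(-n)(K (x)^L_R A) *)
Definition TorK (n : nat) : endofunctor R :=
  @Endofunctor R (fun A => chH (ltens A) n) (fun A B f => chHmap (ltens_map f) n)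
    (fun A => chHmap_id (@ltens_map_id A))
    (fun A B C g f => chHmap_comp (@ltens_map_comp A B C g f)).

(* Hom_R(K, I) with I = inj_res B: its term in cohomological degree n is
   Hom(N0, I^n) (+) Hom(N1, I^(n-1)), with differential
   (g, h) |-> (d g, g k - d h); up to the sign isomorphism h |-> (-1)^n h this
   is the usual Hom complex. *)
Definition rhom (B : lmodType R) : cochain R :=
  cocone (homs_comap k (comap_id (inj_res B))).

Lemma rhom_map_subproof (A B : lmodType R) (f : {linear A -> B}) n x :
  homs_comap (bimap_id N1) (inj_res_map f) n
    (homs_comap k (comap_id (inj_res A)) n x) =
  homs_comap k (comap_id (inj_res B)) n
    (homs_comap (bimap_id N0) (inj_res_map f) n x).
Proof. by apply/val_inj/funext. Qed.

Definition rhom_map (A B : lmodType R) (f : {linear A -> B}) :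
  comap (rhom A) (rhom B) := cocone_map (rhom_map_subproof f).

Lemma rhom_map_id (A : lmodType R) n x :
  rhom_map (idfun : {linear A -> A}) n x = x.
Proof.
have E N m y : homs_map (bimap_id N) (inj_res_map (@idfun A) m) y = y.
  by apply/val_inj/funext => z; rewrite homs_mapE inj_res_map_id.
case: n x => [|n] x; first exact: E.
by apply: injective_projections; exact: E.
Qed.

Lemma rhom_map_comp (A B C : lmodType R) (g : {linear B -> C})
    (f : {linear A -> B}) n x :
  rhom_map (g \o f) n x = rhom_map g n (rhom_map f n x).
Proof.
have E N m y : homs_map (bimap_id N) (inj_res_map (g \o f) m) y =
  homs_map (bimap_id N) (inj_res_map g m)
    (homs_map (bimap_id N) (inj_res_map f m) y).
  by apply/val_inj/funext => z; rewrite !homs_mapE inj_res_map_comp.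
case: n x => [|n] x; first exact: E.
by apply: injective_projections; exact: E.
Qed.

(* B |-> H^n(RHom_R(K, B)) *)
Definition ExtK (n : nat) : endofunctor R :=
  @Endofunctor R (fun B => coH (rhom B) n) (fun A B f => coHmap (rhom_map f) n)
    (fun A => coHmap_id (@rhom_map_id A))
    (fun A B C g f => coHmap_comp (@rhom_map_comp A B C g f)).
End TwoTerm.
End Derived.

Section RingHomomorphism.
Variables (R U : pzRingType) (u : {rmorphism R -> U}).

Definition regbimod : bimodule R :=
  @Bimodule R R^o (fun x r => x * r) (@mulrDl R) (@mulrDr R) (@mulr1 R)
    (fun x r s => mulrA x r s) (fun a x r => esym (mulrA a x r)).

Definition restr of {rmorphism R -> U} : Type := U.
HB.instance Definition _ := GRing.Zmodule.on (restr u).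
Definition restr_scale (a : R) (x : restr u) : restr u := u a * (x : U).
Lemma restr_scaleA a b x : restr_scale a (restr_scale b x) = restr_scale (a * b) x.
Proof. by rewrite /restr_scale rmorphM mulrA. Qed.
Lemma restr_scale1 : left_id 1 restr_scale.
Proof. by move=> x; rewrite /restr_scale rmorph1 mul1r. Qed.
Lemma restr_scaleDr : right_distributive restr_scale +%R.
Proof. by move=> a x y; exact: mulrDr. Qed.
Lemma restr_scaleDl x : {morph restr_scale^~ x : a b / a + b}.
Proof. by move=> a b; rewrite /restr_scale rmorphD mulrDl. Qed.
HB.instance Definition _ := GRing.Zmodule_isLmodule.Build R (restr u)
  restr_scaleA restr_scale1 restr_scaleDr restr_scaleDl.

Definition restr_ract (x : restr u) (r : R) : restr u := (x : U) * u r.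
Lemma restr_ractDl x y r : restr_ract (x + y) r = restr_ract x r + restr_ract y r.
Proof. exact: mulrDl. Qed.
Lemma restr_ractDr x r s : restr_ract x (r + s) = restr_ract x r + restr_ract x s.
Proof. by rewrite /restr_ract rmorphD mulrDr. Qed.
Lemma restr_ract1 x : restr_ract x 1 = x.
Proof. by rewrite /restr_ract rmorph1 mulr1. Qed.
Lemma restr_ractM x r s : restr_ract x (r * s) = restr_ract (restr_ract x r) s.
Proof. by rewrite /restr_ract rmorphM mulrA. Qed.
Lemma restr_ractZ a x r : restr_ract (a *: x) r = a *: restr_ract x r.
Proof. exact: (esym (mulrA _ _ _)). Qed.

Definition Ubimod : bimodule R :=
  @Bimodule R (restr u) restr_ract restr_ractDl restr_ractDr restr_ract1
    restr_ractM restr_ractZ.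

Lemma bimap_u_linear : linear (u : regbimod -> Ubimod).
Proof. by move=> a x y; rewrite rmorphD rmorphM. Qed.

Definition Kcomplex : bimap regbimod Ubimod :=
  @Bimap R regbimod Ubimod (mklin bimap_u_linear) (fun x r => rmorphM u x r).

Section Multiplication.
Let mulU (x : Ubimod) (y : restr u) : restr u := (x : U) * (y : U).

Lemma mulU_Dl x x' y : mulU (x + x') y = mulU x y + mulU x' y.
Proof. exact: mulrDl. Qed.
Lemma mulU_Dr x y y' : mulU x (y + y') = mulU x y + mulU x y'.
Proof. exact: mulrDr. Qed.
Lemma mulU_B x r y : mulU (ract x r) y = mulU x (r *: y).
Proof. exact: (esym (mulrA _ _ _)). Qed.
Lemma mulU_Z r x y : mulU (r *: x) y = r *: mulU x y.
Proof. exact: (esym (mulrA _ _ _)). Qed.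

Definition mult_map : {linear tens Ubimod (restr u) -> restr u} :=
  tens_lift mulU_Dl mulU_Dr mulU_B mulU_Z.
End Multiplication.

Definition ring_epimorphism : Prop := bijective mult_map.

Definition is_zero (M : lmodType R) : Prop := forall x : M, x = 0.

Definition ucomodule (M : lmodType R) : Prop :=
  is_zero (tens Ubimod M) /\ is_zero (Tor Ubimod 1 M).

Definition ucontramodule (C : lmodType R) : Prop :=
  is_zero (homs Ubimod C) /\ is_zero (Ext Ubimod 1 C).

Definition uspecial (A : lmodType R) : Prop :=
  forall y : tens Ubimod A, exists a : A, @ptens R Ubimod A (1 : U) a = y.

Definition ucospecial (B : lmodType R) : Prop :=
  injective (fun f : homs Ubimod B => val f (1 : U)).
End RingHomomorphism.

Section Equivalence.
Variable R : pzRingType.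

(* A natural isomorphism from the identity to F on the full subcategory P. *)
Definition iso_to_id_on (P : lmodType R -> Prop) (F : endofunctor R) : Prop :=
  exists eta : forall M : lmodType R, P M -> {linear M -> F M},
    (forall M (pM : P M), bijective (eta M pM)) /\
    (forall M N (pM : P M) (pN : P N) (f : {linear M -> N}) (x : M),
      eta N pN (f x) = fmap F f (eta M pM x)).

Definition mutually_inverse_equivalences (P Q : lmodType R -> Prop)
    (F G : endofunctor R) : Prop :=
  [/\ forall M, P M -> Q (F M),
      forall C, Q C -> P (G C),
      iso_to_id_on P (fcompose G F) &
      iso_to_id_on Q (fcompose F G)].
End Equivalence.

(* Main.v *)
Require Import Defs.
From HB Require Import structures.
From mathcomp Require Import all_boot all_order all_algebra.
From mathcomp Require Import generic_quotient ring_quotient.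
From mathcomp Require Import boolp classical_sets.
Import Defs.
Set Implicit Arguments.
Unset Strict Implicit.
Unset Printing Implicit Defensive.
Import Order.TTheory GRing.Theory Num.Theory.
Local Open Scope ring_scope.
Local Open Scope quotient_scope.

(** Write J B for the cofree module of B, an injective module containing B, and
    S B = J B / B; write F A for the free module on the set A, and O A for the
    kernel of F A -> A.

    The complex K fits into a triangle R -> U -> K -> R[1]. Hence a left module M
    has a natural map M -> Ext^1(K, M), whose kernel is the image of Hom(U, M) and
    whose cokernel is Ext^1(U, M); and C has a natural map Tor_1(K, C) -> C, whose
    kernel is Tor_1(U, C) and whose image is the kernel of C -> U (x) C. If M is
    u-cospecial and C is u-special, then all these kernels and cokernels are
    U-modules: Ext^1(K, -) and Tor_1(K, -) only change a module by U-modules.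

    Comodules and contramodules do not see such changes. A map of comodules over
    a common module C is bijective as soon as both structure maps to C have
    U-modules as kernels and cokernels, because a comodule T has no nonzero U-module
    quotient and Tor_1(U, T) = 0 ([comodule_bijective]); dually, a contramodule C
    has no nonzero U-submodule and Ext^1(U, C) = 0 ([contramodule_bijective]).
    This applies to the map from M to Tor_1(K, Ext^1(K, M)) over Ext^1(K, M), and
    to the map from Ext^1(K, Tor_1(K, C)) to C under Tor_1(K, C). The former exists
    because Tor_1(K, M) -> M is bijective for a comodule M, and the latter because
    C -> Ext^1(K, C) is bijective for a contramodule C.

    What remains is that Ext^1(K, M) is a special contramodule and that
    Tor_1(K, C) is a cospecial comodule. Tor is handled through Ext: the
    conditions U (x) A = 0 and Tor_1(U, A) = 0 hold if and only if Hom(A, D) = 0,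
    respectively Ext^1(A, D) = 0, for all modules D = Hom(U, J X). So the
    hypotheses on Tor_1(U, U) and Tor_2(U, U) say that Ext^1(U, D) = 0 =
    Ext^2(U, D). The first equality implies Ext^1(U, V) = 0 for each U-module V
    ([ext1_ulocal]) and Ext^1(W, D) = 0 for each U-module W
    ([ext1_ulocal_dual]). Finally, for cospecial M, Ext^1(K, M) is the cokernel
    of the injection of Hom(U, J M) into the pullback of Hom(U, S M) -> S M <- J
    M; and for special C, Tor_1(K, C) is the kernel of the surjection onto U (x)
    F C of the pushout of U (x) O C <- O C -> F C. The vanishing results yield
    Hom and Ext^1 of these modules one after the other ([extK_contramodule],
    [torK1_comodule]). *)

(** * Characters of abelian groups *)

Lemma int_subgroup_principal (I : int -> Prop) :
  I 0 -> (forall m n, I m -> I n -> I (m - n)) ->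
  exists d : nat, forall n, I n <-> (d %| n)%Z.
Proof.
move=> I0 IB; have IN n : I n -> I (- n) by move=> In; rewrite -sub0r; apply: IB.
have ID m n : I m -> I n -> I (m + n) by move=> Im /IN In; rewrite -[n]opprK; apply: IB.
have IM m n : I n -> I (m * n).
  move=> In; elim/int_rect: m => [|m Im|m Im]; first by rewrite mul0r.
    by rewrite -addn1 PoszD mulrDl mul1r; apply: ID.
  by rewrite -addn1 PoszD opprD mulrDl mulN1r; apply: IB.
have [[d [d0 Id]]|noI] := pselect (exists d : nat, (0 < d)%N /\ I d); last first.
  exists 0 => n; rewrite dvd0z; split=> [In|/eqP->//].
  apply/eqP; apply: contrapT => n0; apply: noI; exists `|n|%N; split.
    by rewrite absz_gt0; apply/negP => /eqP n00; apply: n0; rewrite n00.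
  by rewrite /absz; case: n In {n0} => // n /IN; rewrite NegzE opprK.
have ex : exists d : nat, (0 < d)%N && `[< I d >].
  by exists d; rewrite d0; apply/asboolP.
case: (ex_minnP ex) => e /andP[e0 /asboolP Ie] emin; exists e => n.
split=> [In|/dvdzP[q ->]]; last exact: IM.
have Ir : I (n %% e)%Z.
  by rewrite -[(_ %% _)%Z](addKr ((n %/ e)%Z * e)) -divz_eq addrC; apply: IB => //; apply: IM.
have r0 : 0 <= (n %% e)%Z by apply: modz_ge0; rewrite eqz_nat -lt0n.
have rlt : (n %% e)%Z < e by apply: ltz_pmod; rewrite ltz_nat.
apply/dvdz_mod0P; apply: contrapT; case: (n %% e)%Z Ir r0 rlt => // r Ir _ rlt rn0.
have : (0 < r)%N by rewrite lt0n; apply/eqP => re; apply: rn0; rewrite re.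
move=> r0; have := emin r; rewrite r0; move=> /(_ (asboolT Ir)).
by rewrite leqNgt -ltz_nat rlt.
Qed.

Definition ratmod (q : rat) : QmodZ := \pi_QmodZ q.

Lemma ratmodMz q n : ratmod q *~ n = ratmod (q * n%:~R).
Proof. by rewrite /ratmod -(raddfMz (\pi_QmodZ)) -mulrzr. Qed.

Lemma ratmod_eq0 q : ratmod q = 0 <-> q \is a Num.int.
Proof.
have -> : (0 : QmodZ) = ratmod 0 by rewrite /ratmod raddf0.
rewrite /ratmod; split=> [/eqP|qi]; last apply/eqP.
  by rewrite -Quotient.idealrBE subr0.
by rewrite -Quotient.idealrBE subr0.
Qed.

Lemma QmodZ_divisible (y : QmodZ) (d : nat) : (0 < d)%N ->
  exists z, z *~ d = y.
Proof.
move=> d0; exists (ratmod (repr y / d%:R)); rewrite ratmodMz divfK.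
  by rewrite /ratmod reprK.
by rewrite pnatr_eq0 -lt0n.
Qed.

Section Characters.
Variable A : zmodType.
Local Open Scope classical_set_scope.

Record partial_char (G : set (A * QmodZ)) : Prop := PartialChar {
  pchar0 : G (0, 0);
  pcharB : forall p q, G p -> G q -> G (p - q);
  pchar_fun : forall y, G (0, y) -> y = 0 }.

Section Theory.
Variables (G : set (A * QmodZ)) (pG : partial_char G).

Lemma pcharN p : G p -> G (- p).
Proof. by move=> Gp; rewrite -sub0r; apply: pcharB => //; apply: pchar0. Qed.

Lemma pcharD p q : G p -> G q -> G (p + q).
Proof. by move=> Gp /pcharN Gq; rewrite -[q]opprK; apply: pcharB. Qed.

Lemma pcharMz p n : G p -> G (p *~ n).
Proof.
move=> Gp; have H (m : nat) : G (p *+ m).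
  elim: m => [|m IH]; first by rewrite mulr0n; apply: pchar0.
  by rewrite mulrS; apply: pcharD.
by case: n => [m|m]; [apply: H | apply/pcharN/H].
Qed.

Lemma pchar_inj a y z : G (a, y) -> G (a, z) -> y = z.
Proof.
move=> Gy Gz; apply/eqP; rewrite -subr_eq0; apply/eqP/(pchar_fun pG).
suff -> : (0, y - z) = (a, y) - (a, z) by apply: (pcharB pG).
by apply: injective_projections; rewrite /= ?subrr.
Qed.
End Theory.

(** The multiples of a at which G is defined are those of d a for some d; the
    value at a may be any element whose d-th multiple is the value at d a. *)
Lemma pchar_step G (a : A) : partial_char G ->
  exists G', [/\ partial_char G', G `<=` G' & exists y, G' (a, y)].
Proof.
move=> pG; have pairMz (p : A * QmodZ) n : p *~ n = (p.1 *~ n, p.2 *~ n).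
  case: p => x y; have H (m : nat) : (x, y) *+ m = (x *+ m, y *+ m).
    by elim: m => [|m IH] //; rewrite !mulrS IH.
  by case: n => m; rewrite /intmul /= H.
have [|m n [y ym] [z zn]|d Hd] := @int_subgroup_principal (fun n => exists y, G (a *~ n, y)).
- by exists 0; apply: pchar0.
- by exists (y - z); rewrite mulrzBr; apply: (pcharB pG ym zn).
have [yd Gd] : exists y, G (a *~ d, y) by apply/Hd/dvdzz.
have [c cd] : exists c, c *~ d = yd.
  case: d Hd Gd => [|d] Hd Gd; last exact: QmodZ_divisible.
  by exists 0; rewrite (pchar_fun pG Gd) mulr0z.
have cn n y : G (a *~ n, y) -> y = c *~ n.
  move=> Gn; have /dvdzP[q nq] : (d %| n)%Z by apply/Hd; exists y.
  have := pcharMz pG q Gd; rewrite pairMz /= -cd -!mulrzA mulrC -nq => Gn'.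
  exact: (pchar_inj pG Gn Gn').
exists [set p | exists n, G (p - (a, c) *~ n)]; split.
- split=> [|p q [m Gm] [n Gn]|y [n]].
  + by exists 0; rewrite mulr0z subr0; apply: pchar0.
  + exists (m - n); rewrite mulrzBr opprB addrACA -[_ - (_ *~ m)]opprB.
    have := pcharB pG Gm Gn; congr (G _).
    by rewrite opprB opprB addrACA [X in _ = _ + X]addrC.
  + rewrite pairMz /= => Gn; have := pcharN pG Gn.
    rewrite [X in G X](_ : _ = (a *~ n, c *~ n - y)); last first.
      by apply: injective_projections; rewrite /= ?sub0r ?opprK ?opprB.
    by move/cn => /eqP; rewrite subr_eq -subr_eq0 opprD addNKr oppr_eq0 => /eqP.
- by move=> p Gp; exists 0; rewrite mulr0z subr0.
- by exists c, 1; rewrite mulr1z subrr; apply: pchar0.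
Qed.

(** Zorn's lemma turns a maximal partial character into a total one, since
    divisibility of Q/Z extends a partial character to any further element. *)
Lemma pchar_extend (G : set (A * QmodZ)) : partial_char G ->
  exists chi : {additive A -> QmodZ}, forall a y, G (a, y) -> chi a = y.
Proof.
move=> pG.
(* Uniting with G makes the empty chain harmless. *)
pose P (X : set (A * QmodZ)) := partial_char (X `|` G).
have [|X [PX Xmax]] := @Zorn_bigcup _ P.
  move=> F FP tot; split.
  - by right; apply: pchar0.
  - have sub1 X p q : F X -> (X `|` G) p -> (X `|` G) q ->
      ((\bigcup_(X in F) X) `|` G) (p - q).
      move=> FX Xp Xq; case: (pcharB (FP _ FX) Xp Xq) => h; last by right.
      by left; exists X.
    move=> p q [[X FX Xp]|Gp] [[Y FY Yq]|Gq].
    + case: (tot X Y FX FY) => XY.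
        by apply: (@sub1 Y) => //; left; [apply: XY|].
      by apply: (@sub1 X) => //; left; [|apply: XY].
    + by apply: (@sub1 X) => //; [left|right].
    + by apply: (@sub1 Y) => //; [right|left].
    + by right; apply: (pcharB pG).
  - by move=> y [[X FX Xy]|Gy]; [apply: (pchar_fun (FP _ FX)); left|apply: (pchar_fun pG)].
have tot a : exists y, (X `|` G) (a, y).
  have [G' [pG' sG' [y G'y]]] := pchar_step a PX; exists y.
  apply: contrapT => nXy; apply: (Xmax G').
    split; first by move=> p Xp; apply: sG'; left.
    by move=> /(_ _ G'y) Xy; apply: nXy; left.
  by rewrite /P (_ : G' `|` G = G') //; apply/setUidl => p Gp; apply: sG'; right.
pose chi a := projT1 (cid (tot a)).
have chiP a : (X `|` G) (a, chi a) by rewrite /chi; case: cid.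
have chi_add : additive chi.
  by move=> a b; apply: (pchar_inj PX (chiP _)); apply: (pcharB PX (chiP a) (chiP b)).
pose chi' : {additive A -> QmodZ} := HB.pack chi (GRing.isZmodMorphism.Build A QmodZ chi chi_add).
by exists chi' => a y Gy; apply: (pchar_inj PX (chiP a)); right.
Qed.

(** If b has order d, the cyclic group of b has a character that sends b to 1 / d;
    for b of infinite order 1 / 2 will do. *)
Lemma separating_char (b : A) : b <> 0 ->
  exists chi : {additive A -> QmodZ}, chi b <> 0.
Proof.
move=> b0.
have [|m n bm bn|d Hd] := @int_subgroup_principal (fun n => b *~ n = 0).
- exact: mulr0z.
- by rewrite mulrzBr bm bn subrr.
have d1 : d <> 1%N by move=> d1; apply: b0; apply/(Hd 1); rewrite d1.
(* The value d = 0 stands for infinite order. *)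
pose e := if d == 0%N then 2%N else d.
have e1 : (1 < e)%N by rewrite /e; case: d d1 {Hd e} => [|[|d]].
have e0 : (e%:R : rat) != 0 by rewrite pnatr_eq0 -lt0n ltnW.
pose c := ratmod (e%:R)^-1.
have c0 : c <> 0.
  move/ratmod_eq0 => /intrP[m em].
  have em1 : e%:R * m%:~R = 1 :> rat by rewrite -em divff.
  have : (e%:Z * m == 1) by rewrite -(eqr_int rat) rmorphM /= em1.
  move/eqP/(congr1 absz); rewrite abszM => /eqP; rewrite muln_eq1 => /andP[/eqP].
  by rewrite /absz => e1' _; rewrite e1' in e1.
have dc n : b *~ n = 0 -> c *~ n = 0.
  move/Hd => /dvdzP[q ->]; rewrite ratmodMz; apply/ratmod_eq0.
  rewrite /e; case: eqP => [->|/eqP dn0]; first by rewrite mulr0 mulr0 rpred0.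
  rewrite rmorphM /= mulrCA mulVf ?mulr1 ?intr_int //.
  by rewrite pnatr_eq0.
have [|chi chiP] := @pchar_extend [set p | exists n, p = (b *~ n, c *~ n)].
  split=> [|p q [m ->] [n ->]|y [n [bn ->]]].
  - by exists 0; rewrite !mulr0z.
  - by exists (m - n); rewrite !mulrzBr.
  - by apply: dc.
by exists chi; rewrite (chiP _ c) //; exists 1; rewrite !mulr1z.
Qed.
End Characters.

(** * Linear maps, free modules and cofree modules *)

Section LinearMaps.
Variable R : pzRingType.
Implicit Types A B C X Y : lmodType R.

Definition lcomp A B C (g : {linear B -> C}) (f : {linear A -> B}) :
  {linear A -> C} := g \o f.

Lemma lcompE A B C (g : {linear B -> C}) (f : {linear A -> B}) a :
  lcomp g f a = g (f a).
Proof. by []. Qed.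

Definition lsub A B (f g : {linear A -> B}) : {linear A -> B} := f \- g.

Lemma lsubE A B (f g : {linear A -> B}) a : lsub f g a = f a - g a.
Proof. by []. Qed.

Definition lmono A B (f : {linear A -> B}) := forall a, f a = 0 -> a = 0.
Definition lepi A B (f : {linear A -> B}) := forall b, exists a, f a = b.
Definition lexact A B C (f : {linear A -> B}) (g : {linear B -> C}) :=
  forall b, g b = 0 <-> exists a, f a = b.

Lemma lmono_inj A B (f : {linear A -> B}) : lmono f -> injective f.
Proof.
by move=> mf a a' faa'; apply/eqP; rewrite -subr_eq0; apply/eqP/mf; rewrite linearB faa' subrr.
Qed.

Lemma bijective_lin A B (f : {linear A -> B}) :
  lmono f -> lepi f -> bijective f.
Proof.
move=> /lmono_inj fI /choice[g gK]; exists g => [a|//].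
by apply: fI; rewrite gK.
Qed.

Lemma lexact_comp A B C (f : {linear A -> B}) (g : {linear B -> C}) a :
  lexact f g -> g (f a) = 0.
Proof. by move=> ex; apply/ex; exists a. Qed.

Lemma descend A B X (e : {linear A -> B}) (g : {linear A -> X}) : lepi e ->
  (forall a, e a = 0 -> g a = 0) ->
  exists h : {linear B -> X}, forall a, h (e a) = g a.
Proof.
move=> /choice[s eK] eg.
have gs a : g (s (e a)) = g a.
  by apply/eqP; rewrite -subr_eq0 -linearB; apply/eqP/eg; rewrite linearB eK subrr.
have hl : linear (g \o s).
  by move=> a x y; rewrite /comp -{1}[x]eK -{1}[y]eK -linearP gs linearP.
by exists (mklin hl) => a; exact: gs.
Qed.

Lemma corestrict A B X (i : {linear A -> B}) (g : {linear X -> B}) : lmono i ->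
  (forall x, exists a, i a = g x) ->
  exists h : {linear X -> A}, forall x, i (h x) = g x.
Proof.
move=> /lmono_inj iI /choice[h hP].
have hl : linear h by move=> a x y; apply: iI; rewrite linearP !hP linearP.
by exists (mklin hl).
Qed.

Lemma linear_inverse A B (f : {linear A -> B}) : bijective f ->
  exists h : {linear B -> A}, cancel f h /\ cancel h f.
Proof.
move=> [g fK gK]; have [||h hP] := @corestrict _ _ _ f (idfun : {linear B -> B}).
- by move=> a fa; rewrite -[a]fK fa -(linear0 f) fK.
- by move=> b; exists (g b); exact: gK.
by exists h; split=> [a|b]; [apply: (can_inj fK)|]; exact: hP.
Qed.

Lemma free_projective (T : choiceType) X Y (e : {linear X -> Y})
    (g : {linear freem R T -> Y}) : lepi e ->
  exists h : {linear freem R T -> X}, forall x, e (h x) = g x.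
Proof.
move=> /choice[s eK]; exists (freem_lift (fun t => s (g (deltam R t)))).
apply: (@freem_ext R T _ (e \o freem_lift _) g) => [a x y|a x y|t].
- by rewrite linearP.
- by rewrite linearP.
- by rewrite /comp freem_lift_delta eK.
Qed.

(** A linear map from B to Hom_Z(R, (Q/Z)^X) is a family of characters of B,
    and characters extend along injections. *)
Lemma cofree_injective A B X (i : {linear A -> B}) (g : {linear A -> cofreem X}) :
  lmono i -> exists h : {linear B -> cofreem X}, forall a, h (i a) = g a.
Proof.
move=> im; have ext (chi : charm X) : exists psi : {additive B -> QmodZ},
    forall a, psi (i a) = val (g a) 1 chi.
  pose G := [set p : B * QmodZ | exists a, p = (i a, val (g a) 1 chi)]%classic.
  have [|psi psiP] := @pchar_extend B G; last first.
    by exists psi => a; apply: psiP; exists a.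
  split=> [|p q [a ->] [b ->]|y [a [ia ->]]].
  - by exists 0; rewrite !linear0.
  - by exists (a - b); rewrite !linearB.
  - by rewrite (im a (esym ia)) linear0.
have {ext}[psi psiP] := choice ext.
have hadd b : isadditive (fun r chi => psi chi (r *: b)).
  by apply/asboolP => x y; apply/funext => chi; rewrite scalerDl raddfD.
pose h b : cofreem X := exist (@isadditive R X) _ (hadd b).
have hl : linear h.
  move=> a x y; apply/val_inj/funext => r; apply/funext => chi /=.
  by rewrite scalerDr raddfD scalerA.
exists (mklin hl) => a; apply/val_inj/funext => r; apply/funext => chi /=.
by rewrite -linearZ psiP linearZ /= mul1r.
Qed.

Lemma cofree_unit_mono X : lmono (cofree_unit X).
Proof.
move=> b b0; apply: contrapT => /separating_char[chi]; apply.
have := congr1 (fun f => val f 1 chi) b0 => /=.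
by rewrite scale1r.
Qed.

Lemma cofree_test X (x : X) :
  (forall Y (h : {linear X -> cofreem Y}), h x = 0) -> x = 0.
Proof. by move=> h0; apply: cofree_unit_mono; apply: h0. Qed.

Lemma qproj_epi A (S : submodule A) : lepi (qproj S).
Proof. by elim/qprojW=> x; exists x. Qed.

Lemma qproj_exact A B (f : {linear A -> B}) : lexact f (qproj (limg f)).
Proof.
move=> x; rewrite -(linear0 (qproj (limg f))).
by split=> [/quotmP|fx]; [|apply/quotmP]; rewrite subr0.
Qed.

Lemma cosyz_proj_epi X : lepi (cosyz_proj X).
Proof. exact: qproj_epi. Qed.

Lemma cosyz_exact X : lexact (cofree_unit X) (cosyz_proj X).
Proof. exact: qproj_exact. Qed.

Lemma free_cover_epi A : lepi (free_cover A).
Proof. by move=> a; exists (deltam R a); exact: free_cover_delta. Qed.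

Lemma syz_incl_mono A : lmono (syz_incl A).
Proof. by move=> x x0; apply: val_inj. Qed.

Lemma syz_exact A : lexact (syz_incl A) (free_cover A).
Proof.
move=> x; split=> [x0|[a <-]]; last exact: syz_cover.
have Kx : smpred (lker (free_cover A)) x by apply/asboolP.
by exists (exist (fun x => smpred (lker (free_cover A)) x) x Kx).
Qed.
End LinearMaps.

(** * First extension groups *)

Section Extensions.
Variable R : pzRingType.
Implicit Types A B X Y : lmodType R.

(** Vanishing of Ext^1(A, B), computed by the injective coresolution of B, and
    then by the free resolution of A. *)
Definition ext1_inj A B := forall g : {linear A -> cosyz B},
  exists h : {linear A -> cofreem B}, forall a, cosyz_proj B (h a) = g a.

Definition ext1_proj A B := forall g : {linear syz A -> B},
  exists h : {linear freem R A -> B}, forall x, h (syz_incl A x) = g x.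

(** Lift F A -> A -> Y to X, and correct the lift by an extension to F A of its
    restriction O A -> B. *)
Lemma ext1_lift A B X Y (i : {linear B -> X}) (q : {linear X -> Y})
    (g : {linear A -> Y}) : ext1_proj A B -> lmono i -> lepi q -> lexact i q ->
  exists h : {linear A -> X}, forall a, q (h a) = g a.
Proof.
move=> ext im qe ex.
have [h hP] := free_projective (lcomp g (free_cover A)) qe.
have [|k kP] := @corestrict _ _ _ _ i (lcomp h (syz_incl A)) im.
  by move=> x; apply/ex; rewrite lcompE hP lcompE syz_cover linear0.
have [l lP] := ext k.
have [|m mP] := descend (g := lsub h (lcomp i l)) (@free_cover_epi _ A).
  by move=> _ /syz_exact[y <-]; rewrite lsubE lcompE lP kP subrr.
exists m => a; have [x <-] := free_cover_epi a.
by rewrite mP lsubE linearB hP lcompE (lexact_comp _ ex) subr0.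
Qed.

Lemma ext1_extend A B X Y (i : {linear X -> Y}) (q : {linear Y -> A})
    (g : {linear X -> B}) : ext1_inj A B -> lmono i -> lepi q -> lexact i q ->
  exists h : {linear Y -> B}, forall x, h (i x) = g x.
Proof.
move=> ext im qe ex.
have [h hP] := cofree_injective (lcomp (cofree_unit B) g) im.
have [|k kP] := @descend _ _ _ _ q (lcomp (cosyz_proj B) h) qe.
  by move=> _ /ex[y <-]; rewrite lcompE hP lcompE cosyz_unit.
have [l lP] := ext k.
have [|m mP] := corestrict (g := lsub h (lcomp l q)) (@cofree_unit_mono _ B).
  by move=> x; apply/cosyz_exact; rewrite lsubE linearB lcompE lP kP subrr.
exists m => x; apply: (lmono_inj (@cofree_unit_mono _ B)).
by rewrite mP lsubE lcompE (lexact_comp _ ex) linear0 subr0 hP.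
Qed.

Lemma ext1_projP A B : ext1_proj A B <-> ext1_inj A B.
Proof.
split=> ext g.
  apply: (ext1_lift g ext (@cofree_unit_mono _ B)).
    exact: cosyz_proj_epi.
  exact: cosyz_exact.
apply: (ext1_extend g ext (@syz_incl_mono _ A)); first exact: free_cover_epi.
exact: syz_exact.
Qed.

(** Both Ext^1(O A, B) and Ext^1(A, S B) are Ext^2(A, B). *)
Lemma ext1_shift A B : ext1_proj (syz A) B -> ext1_proj A (cosyz B).
Proof.
move=> /ext1_projP ext g; have [h hP] := ext g.
have [k kP] := cofree_injective h (@syz_incl_mono _ A).
by exists (lcomp (cosyz_proj B) k) => x; rewrite lcompE kP hP.
Qed.
End Extensions.

(** * Tensor products and Hom *)

Section Adjunction.
Variables (R : pzRingType) (N : bimodule R).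
Implicit Types A B X : lmodType R.

Definition homlin B (f : homs N B) : {linear N -> B} := mklin (homs_linear f).

Definition linhom B (f : {linear N -> B}) : homs N B :=
  exist (@islinear R N B) f (asboolT (linearP f)).

Definition hpost B B' (g : {linear B -> B'}) : {linear homs N B -> homs N B'} :=
  homs_map (bimap_id N) g.

Lemma hpostE B B' (g : {linear B -> B'}) f x : val (hpost g f) x = g (val f x).
Proof. by []. Qed.

Lemma homsP B (f g : homs N B) : (forall x, val f x = val g x) -> f = g.
Proof. by move=> fg; apply/val_inj/funext. Qed.

Lemma homsD B (f g : homs N B) x : val (f + g) x = val f x + val g x.
Proof. by []. Qed.

Lemma homsN B (f : homs N B) x : val (- f) x = - val f x.
Proof. by []. Qed.

Lemma homsZ B a (f : homs N B) x : val (a *: f) x = val f (ract x a).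
Proof. by []. Qed.

Lemma homs_argD B (f : homs N B) x y : val f (x + y) = val f x + val f y.
Proof. exact: (linearD (homlin f)). Qed.

Lemma homs_argZ B (f : homs N B) a x : val f (a *: x) = a *: val f x.
Proof. exact: (linearZ_LR (homlin f)). Qed.

Section Curry.
Variables A B : lmodType R.

Lemma curry_subproof (h : {linear tens N A -> B}) a :
  islinear (fun x : N => h (ptens x a)).
Proof. by apply/asboolP => c x y; rewrite ptensDl ptensZ linearP. Qed.

Definition curryf (h : {linear tens N A -> B}) a : homs N B :=
  exist (@islinear R N B) _ (curry_subproof h a).

Lemma curry_linear h : linear (curryf h).
Proof.
move=> c a a'; apply: homsP => x.
by rewrite homsD homsZ /= ptensDr linearD ptensB.
Qed.

Definition curry h : {linear A -> homs N B} := mklin (curry_linear h).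

Lemma curryE h a x : val (curry h a) x = h (ptens x a).
Proof. by []. Qed.

Variable g : {linear A -> homs N B}.

Lemma uncurryDl x x' a : val (g a) (x + x') = val (g a) x + val (g a) x'.
Proof. exact: homs_argD. Qed.
Lemma uncurryDr x a a' : val (g (a + a')) x = val (g a) x + val (g a') x.
Proof. by rewrite linearD. Qed.
Lemma uncurryB x r a : val (g a) (ract x r) = val (g (r *: a)) x.
Proof. by rewrite linearZ. Qed.
Lemma uncurryZ r x a : val (g a) (r *: x) = r *: val (g a) x.
Proof. exact: homs_argZ. Qed.

Definition uncurry : {linear tens N A -> B} :=
  tens_lift uncurryDl uncurryDr uncurryB uncurryZ.

Lemma uncurryE x a : uncurry (ptens x a) = val (g a) x.
Proof. exact: tens_lift_ptens. Qed.
End Curry.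

Lemma tens_linP A B (f g : {linear tens N A -> B}) :
  (forall x a, f (ptens x a) = g (ptens x a)) -> f =1 g.
Proof. by move=> fg; apply: tens_ext => // a x y; rewrite linearP. Qed.

Definition tpost A A' (f : {linear A -> A'}) : {linear tens N A -> tens N A'} :=
  tens_map (bimap_id N) f.

Lemma tpostE A A' (f : {linear A -> A'}) x a :
  tpost f (ptens x a) = ptens x (f a).
Proof. exact: tens_map_ptens. Qed.

Lemma ptens0 A x : ptens x (0 : A) = 0 :> tens N A.
Proof. by apply: (addrI (ptens x 0)); rewrite -ptensDr !addr0. Qed.

Lemma ptensN A x (a : A) : ptens x (- a) = - ptens x a :> tens N A.
Proof. by apply: (addrI (ptens x a)); rewrite -ptensDr !subrr ptens0. Qed.

(** Maps from N (x) A to J X are maps from A to Hom(N, J X), and a module without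
    nonzero maps to the modules J X is zero. *)
Lemma tens_eq0P A :
  (forall x : tens N A, x = 0) <->
  forall X (g : {linear A -> homs N (cofreem X)}) a, g a = 0.
Proof.
split=> [t0 X g a|g0 t].
  by apply: homsP => x; rewrite -uncurryE (t0 (ptens _ _)) linear0.
apply: cofree_test => Y h.
apply: (@tens_linP _ _ h (@lzero R _ _)) => x a.
by rewrite -curryE g0.
Qed.

(** Modulo the image of N (x) O A, the class of n (x) x depends only on n and on
    the image of x in A, which gives an inverse of N (x) F A / N (x) O A -> N (x) A. *)
Lemma tens_cover_exact A : lexact (tpost (syz_incl A)) (tpost (free_cover A)).
Proof.
move=> z; split=> [|[y <-]]; last first.
  rewrite -lcompE; apply: (@tens_linP _ _ _ (@lzero R _ _)) => x s.
  by rewrite lcompE !tpostE syz_cover ptens0.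
set S := limg (tpost (syz_incl A)); pose q : {linear tens N (freem R A) -> quotm S} := qproj S.
have qS x y : free_cover A x = free_cover A y ->
    forall n, q (ptens n x) = q (ptens n y).
  move=> xy n; apply/quotmP; have /syz_exact[s sP] : free_cover A (x - y) = 0.
    by rewrite linearB xy subrr.
  by exists (ptens n s); rewrite tpostE sP ptensDr ptensN.
pose d : A -> freem R A := @deltam R A.
have dK a : free_cover A (d a) = a by exact: free_cover_delta.
have bDl n n' a : q (ptens (n + n') (d a)) = q (ptens n (d a)) + q (ptens n' (d a)).
  by rewrite ptensDl linearD.
have bDr n a a' : q (ptens n (d (a + a'))) = q (ptens n (d a)) + q (ptens n (d a')).
  by rewrite -linearD -ptensDr; apply: qS; rewrite linearD !dK.
have bB n r a : q (ptens (ract n r) (d a)) = q (ptens n (d (r *: a))).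
  by rewrite ptensB; apply: qS; rewrite linearZ !dK.
have bZ r n a : q (ptens (r *: n) (d a)) = r *: q (ptens n (d a)).
  by rewrite ptensZ linearZ.
pose s := tens_lift bDl bDr bB bZ.
have sK : lcomp s (tpost (free_cover A)) =1 q.
  apply: tens_linP => n x; rewrite lcompE tpostE tens_lift_ptens.
  by apply: qS; rewrite dK.
move=> z0; have : q z = 0 by rewrite -sK lcompE z0 linear0.
by move/qproj_exact.
Qed.

Lemma tens_cover_epi A : lepi (tpost (free_cover A)).
Proof.
move=> t; set S := limg (tpost (free_cover A)).
suff : qproj S t = 0 by move/qproj_exact.
apply: (@tens_linP _ _ (qproj S) (@lzero R _ _)) => n a.
apply/qproj_exact.
by exists (ptens n (deltam R a)); rewrite tpostE free_cover_delta.
Qed.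

(** The kernel of this map is Tor_1(N, A), since Tor_1(N, F A) = 0. *)
Definition Tor1_zero A := lmono (tpost (syz_incl A)).

(** The map N (x) O A -> N (x) F A is injective if and only if all maps from its
    source to the injective modules J X extend to its target. *)
Lemma Tor1_zeroP A :
  Tor1_zero A <-> forall X, ext1_proj A (homs N (cofreem X)).
Proof.
split=> [tor X g|ext].
  have [h hP] := cofree_injective (uncurry g) tor.
  exists (curry h) => x; apply: homsP => n.
  by rewrite curryE -uncurryE -hP tpostE.
move=> t t0; apply: cofree_test => Y h; have [g gP] := ext Y (curry h).
suff -> : h t = uncurry g (tpost (syz_incl A) t) by rewrite t0 linear0.
rewrite -lcompE; move: t {t0}; apply: tens_linP => n a.
by rewrite lcompE tpostE uncurryE gP curryE.
Qed.
End Adjunction.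

(** * Modules over the epimorphism *)

Section LocalModules.
Variables (R U : pzRingType) (u : {rmorphism R -> U}).
Hypothesis u_epi : ring_epimorphism u.
Implicit Types A B V X : lmodType R.
Local Notation N := (Ubimod u).
Local Notation RU := (restr u).
Local Notation one := (1 : U).

Lemma heval_linear B : linear (fun f : homs N B => val f one).
Proof.
move=> a f g; rewrite homsD homsZ -homs_argZ; congr (val f _ + _).
by rewrite [LHS]mul1r [RHS]mulr1.
Qed.
Definition heval B : {linear homs N B -> B} := mklin (@heval_linear B).

Lemma hevalE B f : heval B f = val f one.
Proof. by []. Qed.

Lemma tens_unit_linear A : linear (fun a : A => ptens (one : N) a).
Proof.
move=> r a b; rewrite ptensDr -ptensB -ptensZ; congr (ptens _ a + _).
by rewrite [LHS]mul1r [RHS]mulr1.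
Qed.
Definition tens_unit A : {linear A -> tens N A} := mklin (@tens_unit_linear A).

Lemma tens_unitE A a : tens_unit A a = ptens (one : N) a.
Proof. by []. Qed.

(** A U-module is encoded as an R-module V with a linear section of the
    evaluation Hom(U, V) -> V at 1; since u is an epimorphism this section is
    unique, and it determines the action of U. *)
Definition ulocal V :=
  exists k : {linear V -> homs N V}, forall v, val (k v) one = v.

Lemma ptens_epi (x y : RU) :
  ptens (x : N) y = ptens ((x : U) * (y : U) : N) (one : RU).
Proof.
apply: (bij_inj u_epi); rewrite /mult_map !tens_lift_ptens.
by rewrite [RHS]mulr1.
Qed.

(** The element f x of Hom(U, B), evaluated at y, is the image of y (x) x under
    the map U (x) U -> B given by f, and y (x) x = yx (x) 1. *)
Lemma hom_to_homs B (f : {linear RU -> homs N B}) (x y : U) :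
  val (f x) y = val (f one) (y * x).
Proof. by rewrite -!uncurryE ptens_epi. Qed.

Section Translation.
Variable B : lmodType R.

Lemma translate_subproof (g : homs N B) (x : U) :
  islinear (fun y : N => val g ((y : U) * x)).
Proof.
apply/asboolP => a y z; rewrite -homs_argZ -homs_argD; congr (val g _).
by rewrite [LHS]mulrDl; congr (_ + _); exact: esym (mulrA _ _ _).
Qed.
Definition translate (g : homs N B) (x : U) : homs N B :=
  exist (@islinear R N B) _ (translate_subproof g x).

Lemma translateE g x (y : U) : val (translate g x) y = val g (y * x).
Proof. by []. Qed.

Lemma translate_arg_linear g : islinear (translate g : N -> homs N B).
Proof.
apply/asboolP => a x y; apply: homsP => z.
rewrite homsD homsZ !translateE -homs_argD; congr (val g _).
by rewrite [LHS]mulrDr; congr (_ + _); exact: mulrA.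
Qed.
Definition translatef g : homs N (homs N B) :=
  exist (@islinear R N (homs N B)) _ (translate_arg_linear g).

Lemma translate_linear : linear translatef.
Proof.
move=> a g h; apply: homsP => x; apply: homsP => y.
rewrite !homsD !homsZ !translateE homsD homsZ; congr (val g _ + _).
exact: esym (mulrA _ _ _).
Qed.

Lemma ulocal_homs : ulocal (homs N B).
Proof.
exists (mklin translate_linear) => g; apply: homsP => x.
by rewrite translateE mulr1.
Qed.
End Translation.

Lemma ulocal_ext V (f g : {linear RU -> V}) :
  ulocal V -> f one = g one -> f =1 g.
Proof.
move=> [k kK] fg x; rewrite -[LHS]kK -[RHS]kK -!lcompE.
by rewrite !(hom_to_homs _ x) !lcompE fg.
Qed.

Lemma ulocal_eq0 V (f : {linear RU -> V}) x : ulocal V -> f one = 0 -> f x = 0.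
Proof. by move=> Vl f0; apply: (@ulocal_ext _ f (@lzero R _ _)). Qed.

Lemma tens_ulocal_ext A V (f g : {linear tens N A -> V}) : ulocal V ->
  (forall a, f (tens_unit A a) = g (tens_unit A a)) -> f =1 g.
Proof.
move=> Vl fg; apply: tens_linP => x a; rewrite -!curryE.
by apply: (ulocal_ext (f := homlin (curry f a)) (g := homlin (curry g a)) Vl); exact: fg.
Qed.

Lemma ulocal_extend A V (f : {linear A -> V}) : ulocal V ->
  exists g : {linear tens N A -> V}, forall a, g (tens_unit A a) = f a.
Proof.
move=> [k kK]; exists (uncurry (lcomp k f)) => a.
by rewrite tens_unitE uncurryE lcompE kK.
Qed.

Lemma ulocal_natural V V' (k : {linear V -> homs N V})
    (k' : {linear V' -> homs N V'}) (g : {linear V -> V'}) :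
  (forall v, val (k v) one = v) -> (forall v, val (k' v) one = v) ->
  forall v x, g (val (k v) x) = val (k' (g v)) x.
Proof.
move=> kK kK' v; rewrite -/(lcomp g (homlin (k v)) _).
apply: (@ulocal_ext _ (lcomp g (homlin (k v))) (homlin (k' (g v)))).
  by exists k'.
by rewrite lcompE /= kK kK'.
Qed.

(** Maps between U-modules are U-linear, so that their kernels, and likewise their
    cokernels, inherit the action of U. *)
Lemma ulocal_ker V V' X (i : {linear X -> V}) (g : {linear V -> V'}) :
  lmono i -> lexact i g -> ulocal V -> ulocal V' -> ulocal X.
Proof.
move=> im ex [k kK] V'l.
have hm : lmono (hpost N i).
  by move=> f f0; apply: homsP => x; apply: im; rewrite -hpostE f0.
have [|h hP] := corestrict (g := lcomp k i) hm.
  move=> x; have [|f fP] := corestrict (g := homlin (k (i x))) im.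
    move=> y; apply/ex; rewrite -[LHS]lcompE; apply: ulocal_eq0 => //.
    by rewrite lcompE /= kK (lexact_comp _ ex).
  by exists (linhom f); apply: homsP.
exists h => x; apply: (lmono_inj im).
by rewrite -hpostE hP lcompE kK.
Qed.

Lemma ulocal_coker V V' X (g : {linear V -> V'}) (q : {linear V' -> X}) :
  lepi q -> lexact g q -> ulocal V -> ulocal V' -> ulocal X.
Proof.
move=> qe ex [k kK] [k' kK'].
have [|h hP] := descend (g := lcomp (hpost N q) k') qe.
  move=> _ /ex[v <-]; apply: homsP => x; rewrite lcompE hpostE.
  by rewrite -(ulocal_natural g kK kK') (lexact_comp _ ex).
exists h => x; have [v <-] := qe x.
by rewrite hP lcompE hpostE kK'.
Qed.

Lemma ulocal_tens A : ulocal (tens N A).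
Proof.
pose k := lcomp (mklin (@translate_linear (tens N A)))
  (curry (idfun : {linear tens N A -> tens N A})).
exists (uncurry k); apply: (tens_linP (f := lcomp (heval _) (uncurry k))
  (g := idfun)) => x a.
by rewrite lcompE uncurryE hevalE /= mul1r.
Qed.

(** The modules Hom(U, J) with J injective. They are injective relative to
    U-modules, and Ext into them is dual to Tor. *)
Definition dual X : lmodType R := homs N (cofreem X).

Definition dual_unit V (k : {linear V -> homs N V}) : {linear V -> dual V} :=
  lcomp (hpost N (cofree_unit V)) k.

Lemma dual_unitE V (k : {linear V -> homs N V}) v x :
  val (dual_unit k v) x = cofree_unit V (val (k v) x).
Proof. by []. Qed.

Lemma dual_unit_mono V (k : {linear V -> homs N V}) :
  (forall v, val (k v) one = v) -> lmono (dual_unit k).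
Proof.
move=> kK v v0; rewrite -[v]kK; apply: cofree_unit_mono.
by rewrite -dual_unitE v0.
Qed.

(** A map V -> Hom(U, J) amounts to a map V -> J, which extends to V'. *)
Lemma dual_injective V V' X (i : {linear V -> V'}) (g : {linear V -> dual X}) :
  ulocal V -> ulocal V' -> lmono i ->
  exists h : {linear V' -> dual X}, forall v, h (i v) = g v.
Proof.
move=> [k kK] [k' kK'] im.
have [h hP] := cofree_injective (lcomp (heval _) g) im.
exists (lcomp (hpost N h) k') => v; apply: homsP => x.
rewrite lcompE hpostE -(ulocal_natural i kK kK') hP lcompE hevalE.
have [kd kdK] := ulocal_homs (cofreem X).
rewrite (ulocal_natural g kK kdK).
by rewrite (hom_to_homs (homlin (kd (g v)))) mul1r /= kdK.
Qed.

Section TorVanishing.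
Hypothesis ext_dual : forall X, ext1_proj RU (dual X).

(** Embed V into a module Hom(U, J): a map from U to the cokernel, which is a
    U-module, lifts along the projection. *)
Lemma ext1_ulocal V : ulocal V -> ext1_proj RU V.
Proof.
move=> Vl g; have [k kK] := Vl; have im := dual_unit_mono kK.
have [h hP] := ext_dual (lcomp (dual_unit k) g).
pose q := qproj (limg (dual_unit k)).
have qex : lexact (dual_unit k) q by exact: qproj_exact.
have [|l lP] := descend (g := lcomp q h) (@free_cover_epi _ RU).
  by move=> _ /syz_exact[y <-]; rewrite lcompE hP lcompE (lexact_comp _ qex).
have Dl : ulocal (dual V) by exact: ulocal_homs.
have Ll : ulocal (quotm (limg (dual_unit k))).
  by apply: (ulocal_coker _ qex) => //; exact: qproj_epi.
have [v vP] := qproj_epi (l one); have [kD kDK] := Dl.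
have lE : lcomp q (homlin (kD v)) =1 l.
  by apply: ulocal_ext => //; rewrite lcompE /= kDK.
have [|m mP] := corestrict (g := lsub h (lcomp (homlin (kD v)) (free_cover RU))) im.
  by move=> x; apply/qex; rewrite lsubE linearB -(lcompE q h) -lP -lE !lcompE subrr.
exists m => x; apply: (lmono_inj im).
by rewrite mP lsubE lcompE syz_cover linear0 subr0 hP.
Qed.

(** The module V = Hom(U, J) is a direct summand of the U-module Hom(U, J V), with
    complement Hom(U, S V). A map from a U-module W to S V amounts to a map from W
    to Hom(U, S V), and therefore lifts to Hom(U, J V). *)
Lemma ext1_ulocal_dual W X : ulocal W -> ext1_inj W (dual X).
Proof.
move=> [k kK] g; set V := dual X in g *.
have Vl : ulocal V by exact: ulocal_homs.
have [kV kVK] := Vl; have im := dual_unit_mono kVK.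
have [|r rK] := dual_injective (idfun : {linear V -> V}) Vl _ im.
  exact: ulocal_homs.
have qe : lepi (hpost N (cosyz_proj V)).
  move=> f; have [h hP] := (ext1_projP _ _).1 (ext1_ulocal Vl) (homlin f).
  by exists (@linhom R N _ h); apply: homsP.
(* The section of Hom(U, J V) -> Hom(U, S V) complementary to the retraction r. *)
have [|s sP] := descend (g := lsub idfun (lcomp (dual_unit kV) r)) qe.
  move=> f f0; have [|v vP] := corestrict (g := homlin f) (@cofree_unit_mono _ V).
    by move=> x; apply/cosyz_exact; rewrite -hpostE f0.
  have -> : f = dual_unit kV (v one).
    apply: homsP => x; rewrite dual_unitE -[LHS]vP; congr (cofree_unit V _).
    by apply: (@ulocal_ext _ v (homlin (kV (v one)))) => //=; rewrite kVK.
  by rewrite lsubE lcompE rK subrr.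
exists (lcomp (heval (cofreem V)) (lcomp s (lcomp (hpost N g) k))) => w.
rewrite !lcompE; have [f fP] := qe (hpost N g (k w)).
rewrite -fP sP hevalE lsubE lcompE homsD homsN linearB dual_unitE cosyz_unit subr0.
by rewrite -hpostE fP hpostE kK.
Qed.
End TorVanishing.

(** Maps from U (x) R^(T) are families of maps from U indexed by T. *)
Lemma ext1_tens_free (T : choiceType) B :
  ext1_inj RU B -> ext1_inj (tens N (freem R T)) B.
Proof.
move=> ext g.
have lift x : exists f : homs N (cofreem B),
    forall y, cosyz_proj B (val f y) = g (ptens y (deltam R x)).
  have [h hP] := ext (homlin (curry g (deltam R x))).
  by exists (@linhom R N _ h).
have [t tP] := choice lift.
exists (uncurry (freem_lift t)); rewrite -/(lcomp _ _).
apply: (tens_linP (f := lcomp (cosyz_proj B) (uncurry (freem_lift t)))) => y a.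
rewrite lcompE uncurryE -curryE -hpostE; congr (val _ y); rewrite -lcompE.
move: a; apply: freem_ext => [c a b|c a b|x]; rewrite ?linearP //.
by apply: homsP => z; rewrite lcompE hpostE freem_lift_delta tP curryE.
Qed.
End LocalModules.

(** * Comodules and contramodules *)

Section Homology.
Variable R : pzRingType.

Lemma homology_eq0P (A B C : lmodType R) (f : {linear A -> B}) (g : {linear B -> C}) :
  is_zero (homology f g) <-> forall b, g b = 0 -> exists a, f a = b.
Proof.
split=> [H0 b gb|ex].
  have Kb : smpred (lker g) b by apply/asboolP.
  have : qproj (boundary f g) (exist (fun x => smpred (lker g) x) b Kb) = 0 by exact: H0.
  by rewrite -(linear0 (qproj _)) => /quotmP; rewrite subr0.
elim/qprojW=> b; rewrite -(linear0 (qproj _)); apply/quotmP; rewrite subr0.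
by apply: ex; move: (valP b) => /asboolP.
Qed.

Lemma syz_homologyP (N : bimodule R) A :
  is_zero (homology (tpost N (free_step (syz A))) (tpost N (free_step A))) <->
  Tor1_zero N A.
Proof.
have stepE X : tpost N (free_step X) =1
    lcomp (tpost N (syz_incl X)) (tpost N (free_cover (syz X))).
  by apply: tens_linP => x a; rewrite lcompE !tpostE.
apply: iff_trans (homology_eq0P _ _) _; split=> [ex t t0|tor b].
  have [b bt] := tens_cover_epi t; have [|a ab] := ex b.
    by rewrite stepE lcompE bt.
  by rewrite -bt -ab stepE lcompE; apply: lexact_comp; exact: tens_cover_exact.
rewrite stepE lcompE => /tor /tens_cover_exact[y <-].
by have [z <-] := tens_cover_epi y; exists z; rewrite stepE.
Qed.

Lemma Tor1P (N : bimodule R) A : is_zero (Tor N 1 A) <-> Tor1_zero N A.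
Proof. exact (syz_homologyP N A). Qed.

Lemma Tor2P (N : bimodule R) A : is_zero (Tor N 2 A) <-> Tor1_zero N (syz A).
Proof. exact (syz_homologyP N (syz A)). Qed.

Lemma Ext1P (N : bimodule R) B : is_zero (Ext N 1 B) <-> ext1_inj N B.
Proof.
suff -> : is_zero (Ext N 1 B) <-> forall g : homs N (cofreem (cosyz B)),
    hpost N (cofree_step (cosyz B)) g = 0 ->
    exists h, hpost N (cofree_step B) h = g.
  split=> [ex g|ext g g0].
    have [|h hP] := ex (linhom (lcomp (cofree_unit _) g)).
      by apply: homsP => x; rewrite hpostE cofree_stepE [cosyz_proj _ _]cosyz_unit linear0.
    exists (homlin h) => a; apply: (lmono_inj (@cofree_unit_mono _ _)).
    exact: (congr1 (fun f => val f a) hP).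
  have [|f fP] := corestrict (g := homlin g) (@cofree_unit_mono _ (cosyz B)).
    move=> x; apply/cosyz_exact/cofree_unit_mono.
    exact: (congr1 (fun f => val f x) g0).
  have [h hP] := ext f; exists (linhom h); apply: homsP => x.
  by rewrite hpostE cofree_stepE [cosyz_proj _ _]hP fP.
exact: homology_eq0P.
Qed.
End Homology.

Section Comodules.
Variables (R U : pzRingType) (u : {rmorphism R -> U}).
Hypothesis u_epi : ring_epimorphism u.
Implicit Types A B C L M S T : lmodType R.
Local Notation N := (Ubimod u).
Local Notation RU := (restr u).
Local Notation one := (1 : U).

(** Testing against the modules Hom(U, J X) replaces the two conditions on the
    tensor product and Tor by conditions on Hom and Ext^1. *)
Definition comodule M :=
  (forall X (g : {linear M -> dual u X}) m, g m = 0) /\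
  (forall X, ext1_proj M (dual u X)).

Lemma ucomoduleP M : ucomodule u M <-> comodule M.
Proof.
split=> [[/tens_eq0P t0 /Tor1P/Tor1_zeroP t1]|[t0 t1]]; first by split.
by split; [apply/tens_eq0P | apply/Tor1P/Tor1_zeroP].
Qed.

Definition contramodule C :=
  (forall (f : {linear RU -> C}) x, f x = 0) /\ ext1_proj RU C.

Lemma ucontramoduleP C : ucontramodule u C <-> contramodule C.
Proof.
split=> [[h0 /Ext1P/ext1_projP h1]|[h0 h1]]; split=> //.
- by move=> f x; have := congr1 (fun g => val g x) (h0 (@linhom R N _ f)).
- by move=> f; apply: homsP => x; apply: (h0 (homlin f)).
- exact/Ext1P/ext1_projP.
Qed.

Lemma hom_comodule_ulocal T L (g : {linear T -> L}) :
  comodule T -> ulocal u L -> forall t, g t = 0.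
Proof.
move=> [T0 _] [k kK] t; apply: (dual_unit_mono kK).
by rewrite -lcompE T0.
Qed.

Lemma ulocal_contramodule_eq0 L C (i : {linear L -> C}) :
  contramodule C -> ulocal u L -> forall l, i l = 0.
Proof.
move=> [C0 _] [k kK] l; rewrite -[l]kK.
exact: (C0 (lcomp i (homlin (k l)))).
Qed.

Definition kernel_ulocal A B (f : {linear A -> B}) :=
  exists L (i : {linear L -> A}), [/\ ulocal u L, lmono i & lexact i f].

Definition cokernel_ulocal A B (f : {linear A -> B}) :=
  exists L (q : {linear B -> L}), [/\ ulocal u L, lepi q & lexact f q].

(** A comodule has no nonzero maps to a U-module, so the U-module quotients of
    T vanish; and a U-module N that is the kernel of a surjection M -> T has
    U (x) N embedded in U (x) M, as Tor_1(U, T) = 0. *)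
Lemma comodule_bijective M T C (phi : {linear M -> T}) (p : {linear T -> C}) :
  comodule M -> comodule T -> kernel_ulocal p ->
  kernel_ulocal (lcomp p phi) -> cokernel_ulocal (lcomp p phi) ->
  bijective phi.
Proof.
move=> cM cT [L [i [Ll im iex]]] [L1 [i1 [L1l i1m i1ex]]] [Q [q [Ql qe qex]]].
have [|th thP] := corestrict (g := lcomp phi i1) im.
  by move=> l; apply/iex; rewrite lcompE -lcompE (lexact_comp _ i1ex).
(* The cokernel of phi is a quotient of the kernel L of p. *)
have epi_phi : lepi phi.
  pose r : {linear T -> quotm (limg phi)} := qproj (limg phi).
  have rex : lexact phi r by exact: qproj_exact.
  have dec t : exists m l, t = phi m + i l.
    have /qex[m mt] : q (p t) = 0 by rewrite -lcompE (hom_comodule_ulocal _ cT).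
    have /iex[l lt] : p (t - phi m) = 0 by rewrite linearB -(lcompE p phi) mt subrr.
    by exists m, l; rewrite lt addrC subrK.
  have Yl : ulocal u (quotm (limg phi)).
    apply: (@ulocal_coker _ _ _ u_epi L1 L _ th (lcomp r i)) => //.
      move=> y; have [t <-] := qproj_epi y; have [m [l ->]] := dec t.
      by exists l; rewrite lcompE linearD (lexact_comp _ rex) add0r.
    move=> l; rewrite lcompE; split=> [/rex[m ml]|[l1 <-]].
      have /i1ex[l1 l1m] : lcomp p phi m = 0.
        by rewrite lcompE ml (lexact_comp _ iex).
      by exists l1; apply: (lmono_inj im); rewrite thP lcompE l1m.
    by rewrite thP lcompE (lexact_comp _ rex).
  by move=> t; apply/rex; apply: (hom_comodule_ulocal _ cT Yl).
apply: bijective_lin => // m m0.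
pose Nk := subm (lker th); pose v : {linear Nk -> L1} := val : Nk -> L1.
have vm : lmono v by move=> x x0; apply: val_inj.
have vex : lexact v th.
  move=> l; split=> [l0|[x <-]]; last by move: (valP x) => /asboolP.
  have Kl : smpred (lker th) l by apply/asboolP.
  by exists (exist (fun x => smpred (lker th) x) l Kl).
have Nl : ulocal u Nk by apply: (ulocal_ker u_epi vm vex).
have [k kK] := Nl; have jm : lmono (lcomp i1 v) by move=> x /i1m/vm.
have jex : lexact (lcomp i1 v) phi.
  move=> x; split=> [x0|[y <-]].
    have /i1ex[l lx] : lcomp p phi x = 0 by rewrite lcompE x0 linear0.
    have /vex[y yl] : th l = 0 by apply: im; rewrite thP lcompE lx.
    by exists y; rewrite lcompE yl.
  by rewrite lcompE -lcompE -thP (lexact_comp _ vex) linear0.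
have [h hP] := ext1_extend (dual_unit k) ((ext1_projP _ _).1 (cT.2 Nk)) jm epi_phi jex.
have /jex[x <-] := m0; rewrite (dual_unit_mono kK (a := x)) ?linear0 //.
by rewrite -hP cM.1.
Qed.

(** Dually, the submodules of S that are U-modules vanish; and a U-module W that
    is the cokernel of an injection S -> C satisfies W = Hom(U, W) = 0, as
    Hom(U, C) = 0 = Ext^1(U, S). *)
Lemma contramodule_bijective M S C (j : {linear M -> S}) (psi : {linear S -> C}) :
  contramodule S -> contramodule C -> cokernel_ulocal j ->
  kernel_ulocal (lcomp psi j) -> cokernel_ulocal (lcomp psi j) ->
  bijective psi.
Proof.
move=> cS cC [Q [q [Ql qe qex]]] [L1 [i1 [L1l i1m i1ex]]] [Q1 [q1 [Q1l q1e q1ex]]].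
have [|th thP] := descend (g := lcomp q1 psi) qe.
  by move=> _ /qex[m <-]; rewrite lcompE -(lcompE psi j) (lexact_comp _ q1ex).
have ji1 l : j (i1 l) = 0 by rewrite -(lcompE j i1) (ulocal_contramodule_eq0 _ cS).
pose K := subm (lker psi); pose v : {linear K -> S} := val : K -> S.
have vm : lmono v by move=> x x0; apply: val_inj.
have vex : lexact v psi.
  move=> l; split=> [l0|[x <-]]; last by move: (valP x) => /asboolP.
  have Kl : smpred (lker psi) l by apply/asboolP.
  by exists (exist (fun x => smpred (lker psi) x) l Kl).
(* The kernel of psi embeds into the cokernel Q of j. *)
have mono_psi : lmono psi.
  have Kl : ulocal u K.
    apply: (@ulocal_ker _ _ _ u_epi Q Q1 K (lcomp q v) th) => //.
      move=> x; rewrite lcompE => /qex[m mx].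
      have /i1ex[l lm] : lcomp psi j m = 0 by rewrite lcompE mx (lexact_comp _ vex).
      by apply: vm; rewrite -mx -lm ji1.
    move=> y; split=> [|[x <-]]; last by rewrite thP lcompE (lexact_comp _ vex) linear0.
    have [s <-] := qe y; rewrite thP => /q1ex[m ms].
    have /vex[x xs] : psi (s - j m) = 0 by rewrite linearB -ms lcompE subrr.
    by exists x; rewrite lcompE xs linearB (lexact_comp _ qex) subr0.
  by move=> s /vex[x <-]; apply: (ulocal_contramodule_eq0 _ cS Kl).
apply: bijective_lin => // c.
pose r : {linear C -> quotm (limg psi)} := qproj (limg psi).
have rex : lexact psi r by exact: qproj_exact.
apply/rex; have [|w wP] := descend (g := r) q1e.
  by move=> _ /q1ex[m <-]; rewrite lcompE (lexact_comp _ rex).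
have Yl : ulocal u (quotm (limg psi)).
  apply: (@ulocal_coker _ _ _ u_epi Q Q1 _ th w) => //.
    by move=> y; have [b <-] := qproj_epi y; exists (q1 b); rewrite wP.
  move=> y; have [b <-] := q1e y; rewrite wP; split=> [/rex[s <-]|[z]].
    by exists (q s); rewrite thP.
  have [s <-] := qe z; rewrite thP lcompE => /eqP.
  rewrite eq_sym -subr_eq0 -linearB => /eqP/q1ex[m mb]; apply/rex.
  by exists (j m + s); rewrite linearD -(lcompE psi j) mb subrK.
have [k kK] := Yl; rewrite -[r c]kK.
have [h hP] := ext1_lift (homlin (k (r c))) cS.2 mono_psi (@qproj_epi _ _ (limg psi)) rex.
by rewrite -[val _ _]hP cC.1 linear0.
Qed.

(** The element x (x) e equals 1 (x) a whenever the class of a in the U-module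
    E / M is x times the class of e. Indeed a map U (x) E -> J is a map from E to
    Hom(U, J), which vanishes on the comodule M and hence factors through E / M. *)
Lemma uspecial_of_cokernel M (E : lmodType R) (j : {linear M -> E}) :
  comodule M -> cokernel_ulocal j -> uspecial u E.
Proof.
move=> cM [L [q [Ll qe qex]]]; have [k kK] := Ll.
have pure (x : N) (e : E) : exists a, ptens (one : N) a = ptens (x : N) e.
  have [a aP] := qe (val (k (q e)) x); exists a.
  apply/eqP; rewrite -subr_eq0; apply/eqP; apply: cofree_test => Y h.
  have [|g gP] := descend (g := curry h) qe.
    by move=> _ /qex[m <-]; rewrite -(lcompE _ j) cM.1.
  have [kd kdK] := ulocal_homs u (cofreem Y).
  rewrite linearB -!curryE -!gP aP.
  rewrite (ulocal_natural u_epi g kK kdK) (hom_to_homs u_epi (homlin (kd (g (q e))))).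
  by rewrite mul1r /= kdK subrr.
move=> y; apply: (qproj_exact (tens_unit u E) y).1.
move: y; apply: (@tens_linP _ _ _ _ (qproj (limg (tens_unit u E))) (@lzero R _ _)) => x e.
by apply/qproj_exact; have [a aP] := pure x e; exists a.
Qed.

(** Two maps U -> T that agree at 1 have a difference that vanishes in C, hence
    lies in the kernel of T -> C, where it is determined by its value at 1. *)
Lemma ucospecial_of_kernel T C (p : {linear T -> C}) :
  contramodule C -> kernel_ulocal p -> ucospecial u T.
Proof.
move=> cC [L [i [Ll im iex]]] f g fg; apply: homsP => x.
have [|h hP] := corestrict (g := lsub (homlin f) (homlin g)) im.
  by move=> y; apply/iex; rewrite -(lcompE p) cC.1.
apply/eqP; rewrite -subr_eq0; apply/eqP; rewrite -[LHS]hP.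
rewrite (ulocal_eq0 u_epi) ?linear0 //; apply: im.
by rewrite hP lsubE /= [val f _]fg subrr.
Qed.
End Comodules.

(** * The functor Ext^1(K, -) *)

Section ExtK.
Variables (R U : pzRingType) (u : {rmorphism R -> U}).
Implicit Types A B C M : lmodType R.
Local Notation N := (Ubimod u).
Local Notation RU := (restr u).
Local Notation one := (1 : U).
Local Notation E M := (ExtK (Kcomplex u) 1 M).
Local Notation cocycle M :=
  (subm (lker (cod (rhom (Kcomplex u) M) 1))).
Local Notation coboundary M :=
  (boundary (cod (rhom (Kcomplex u) M) 0) (cod (rhom (Kcomplex u) M) 1)).

Lemma scale_elem_subproof B (b : B) : islinear (fun r : regbimod R => (r : R) *: b).
Proof. by apply/asboolP => a r s; rewrite scalerDl scalerA. Qed.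
Definition scale_elemf B (b : B) : homs (regbimod R) B :=
  exist (@islinear R (regbimod R) B) _ (scale_elem_subproof b).
Lemma scale_elem_linear B : linear (@scale_elemf B).
Proof.
move=> a b c; apply: homsP => r; rewrite homsD homsZ /=.
by rewrite scalerDr scalerA.
Qed.
Definition scale_elem B : {linear B -> homs (regbimod R) B} :=
  mklin (@scale_elem_linear B).

Lemma scale_elemE B b (r : R) : val (scale_elem B b) r = r *: b.
Proof. by []. Qed.

Lemma scale_elemP B (h : homs (regbimod R) B) : h = scale_elem B (val h (1 : R)).
Proof.
apply: homsP => r; rewrite scale_elemE -homs_argZ; congr (val h _).
exact: esym (mulr1 _).
Qed.

Lemma homs_unit_map B (f : homs N B) :
  homs_map (Kcomplex u) (idfun : {linear B -> B}) f = scale_elem B (val f one).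
Proof.
apply: homsP => r; rewrite scale_elemE -homs_argZ homs_mapE; congr (val f _).
exact: esym (mulr1 _).
Qed.

Lemma hpost_scale_elem B B' (g : {linear B -> B'}) b :
  hpost (regbimod R) g (scale_elem B b) = scale_elem B' (g b).
Proof. by apply: homsP => r; rewrite hpostE !scale_elemE linearZ_LR. Qed.

Lemma scale_elem_inj B : injective (scale_elem B).
Proof.
move=> b c bc; have := congr1 (fun h => val h (1 : R)) bc.
by rewrite !scale_elemE !scale1r.
Qed.

(** Up to the identification of Hom(R, J M) with J M, a cocycle of degree 1 is a
    map g from U to S M together with a lift of g 1 to J M. *)
Lemma cocycleP M (g : homs N (cofreem (cosyz M))) h :
  lker (cod (rhom (Kcomplex u) M) 1) (g, h) <->
  exists2 g' : homs N (cosyz M), g = hpost N (cofree_unit _) g' &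
    exists2 x, h = scale_elem _ x & val g' one = cosyz_proj M x.
Proof.
have -> : lker (cod (rhom (Kcomplex u) M) 1) (g, h) <->
    hpost N (cofree_step (cosyz M)) g = 0 /\
    homs_map (Kcomplex u) idfun g = hpost (regbimod R) (cofree_step M) h.
  have dE : cod (rhom (Kcomplex u) M) 1 (g, h) =
      (hpost N (cofree_step (cosyz M)) g,
       homs_map (Kcomplex u) idfun g - hpost (regbimod R) (cofree_step M) h) by [].
  split=> [gh|[g0 gh]]; last by apply: etrans dE _; rewrite g0 gh subrr.
  have gd := etrans (esym dE) gh; split; first exact: (congr1 fst gd).
  by apply/eqP; rewrite -subr_eq0; apply/eqP; exact: (congr1 snd gd).
rewrite homs_unit_map [h]scale_elemP hpost_scale_elem; set x := val h _.
split=> [[g0 /scale_elem_inj gx]|[g' -> [y /scale_elem_inj -> gy]]].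
  have [|f fP] := corestrict (g := homlin g) (@cofree_unit_mono _ (cosyz M)).
    move=> y; apply/cosyz_exact/cofree_unit_mono.
    exact: (congr1 (fun f => val f y) g0).
  exists (@linhom R N _ f); first by apply: homsP => y; exact: esym (fP y).
  exists x => //; apply: (lmono_inj (@cofree_unit_mono _ _)).
  exact: etrans (fP _) gx.
split; first by apply: homsP => z; rewrite !hpostE cofree_stepE [cosyz_proj _ _]cosyz_unit linear0.
by rewrite hpostE gy.
Qed.

Lemma extK_unit_subproof M (m : M) :
  smpred (lker (cod (rhom (Kcomplex u) M) 1)) (0, scale_elem _ (cofree_unit M m)).
Proof.
apply/asboolP/cocycleP; exists 0; first by rewrite linear0.
by exists (cofree_unit M m) => //; rewrite cosyz_unit.
Qed.
Definition extK_unit_cocycle M (m : M) : cocycle M :=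
  exist (fun x => smpred (lker (cod (rhom (Kcomplex u) M) 1)) x)
    (0, scale_elem _ (cofree_unit M m)) (extK_unit_subproof m).

Definition extK_unitf M (m : M) : E M := qproj (coboundary M) (extK_unit_cocycle m).

Lemma extK_unit_linear M : linear (@extK_unitf M).
Proof.
move=> a m m'; rewrite -linearP; congr qproj; apply: val_inj.
apply: injective_projections; last exact: (linearP (lcomp (scale_elem _) (cofree_unit M))).
by apply: esym; apply: etrans (addr0 _) (scaler0 _ _).
Qed.

(** The map M -> Ext^1(K, M) is induced by the projection of K onto R[1]. *)
Definition extK_unit M : {linear M -> E M} := mklin (@extK_unit_linear M).

Lemma extK_unit_natural M M' (f : {linear M -> M'}) m :
  extK_unit M' (f m) = fmap (ExtK (Kcomplex u) 1) f (extK_unit M m).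
Proof.
rewrite [RHS](homology_map_qproj _ _ _); congr qproj; apply: val_inj.
apply: injective_projections.
  exact: esym (linear0 (homs_map (bimap_id N) (cofree_map (cosyz_map f)))).
apply: etrans (_ : scale_elem _ (cofree_unit M' (f m)) = _) _ => //.
by rewrite -cofree_map_unit -hpost_scale_elem.
Qed.

Definition pullback_eq M :
    {linear (homs N (cosyz M) * cofreem M)%type -> cosyz M} :=
  sum_map (heval u (cosyz M)) (lsub (@lzero R _ _) (cosyz_proj M)).

(** The pullback of Hom(U, S M) -> S M <- J M. *)
Definition pullback M : lmodType R := subm (lker (pullback_eq M)).

Lemma pullbackP M (g : homs N (cosyz M)) x :
  lker (pullback_eq M) (g, x) <-> val g one = cosyz_proj M x.
Proof.
have -> : lker (pullback_eq M) (g, x) <-> val g one + (0 - cosyz_proj M x) = 0 by [].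
by rewrite sub0r; split=> [/eqP|->]; rewrite ?subrr // subr_eq0 => /eqP.
Qed.

Definition mkpullback M g x (gx : val g one = cosyz_proj M x) : pullback M :=
  exist (fun p => smpred (lker (pullback_eq M)) p) (g, x)
    (asboolT ((pullbackP g x).2 gx)).

Lemma pullback_prop M (p : pullback M) :
  val (val p).1 one = cosyz_proj M (val p).2.
Proof. by apply/pullbackP; rewrite -surjective_pairing; move: (valP p) => /asboolP. Qed.

Lemma extK_presentation M : exists e : {linear pullback M -> E M},
  [/\ lepi e,
      forall p, e p = 0 <->
        exists f, val p = (hpost N (cosyz_proj M) f, val f one) &
      forall p m, val p = (0, cofree_unit M m) -> e p = extK_unit M m].
Proof.
pose v : {linear cocycle M -> rhom (Kcomplex u) M 1} := val.
pose w : {linear pullback M -> (homs N (cosyz M) * cofreem M)%type} := val.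
pose c := lcomp (prod_map (hpost N (cofree_unit (cosyz M))) (scale_elem (cofreem M))) w.
have cE p : c p = (hpost N (cofree_unit (cosyz M)) (val p).1, scale_elem _ (val p).2) by [].
have [||d dP] := @corestrict _ _ _ _ v c.
- by move=> x x0; apply: val_inj.
- move=> p; have Kp : smpred (lker (cod (rhom (Kcomplex u) M) 1)) (c p).
    apply/asboolP/cocycleP; exists (val p).1 => //.
    by exists (val p).2 => //; exact: pullback_prop.
  by exists (exist (fun x => smpred (lker (cod (rhom (Kcomplex u) M) 1)) x) (c p) Kp).
exists (lcomp (qproj (coboundary M)) d); split.
- elim/qprojW=> z; case z0: (val z) => [g h].
  have /cocycleP[g' gg' [x hx gx]] : lker (cod (rhom (Kcomplex u) M) 1) (g, h).
    by rewrite -z0; move: (valP z) => /asboolP.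
  exists (mkpullback gx); rewrite lcompE; congr qproj; apply: val_inj.
  by rewrite -[LHS]/(v (d _)) dP z0 gg' hx.
- move=> p; rewrite lcompE -(linear0 (qproj (coboundary M))).
  have dE : val (d p) = c p by exact: dP.
  split=> [/quotmP|[f pf]]; [rewrite subr0|apply/quotmP; rewrite subr0].
    move=> [f]; rewrite dE => fp; exists f; apply: injective_projections.
      apply: homsP => x; apply: (lmono_inj (@cofree_unit_mono _ _)).
      by have := congr1 (fun q => val q.1 x) fp => /esym.
    have := congr1 snd fp; rewrite -[LHS](esym (homs_unit_map f)).
    by move/esym/scale_elem_inj.
  exists f; rewrite dE cE pf; apply: injective_projections.
    by apply: homsP.
  exact: homs_unit_map.
- move=> p m pm; rewrite lcompE; congr qproj; apply: val_inj.
  rewrite -[LHS]/(v (d _)) dP cE pm; apply: injective_projections => //.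
  exact: linear0 (hpost N (cofree_unit (cosyz M))).
Qed.

Lemma extK_unit_kernel M : lexact (heval u M) (extK_unit M).
Proof.
move=> m; have [e [_ eK eU]] := extK_presentation M.
have mE : val (0 : homs N (cosyz M)) one = cosyz_proj M (cofree_unit M m).
  by rewrite cosyz_unit.
have jE := eU (mkpullback mE) m erefl.
split=> [|[f fm]]; rewrite -jE; [move=> /eK[f fp]|].
  have [|h hP] := corestrict (g := homlin f) (@cofree_unit_mono _ M).
    move=> x; apply/cosyz_exact.
    exact: esym (congr1 (fun p => val p.1 x) fp).
  exists (@linhom R N _ h); apply: (lmono_inj (@cofree_unit_mono _ M)).
  exact: etrans (hP one) (esym (congr1 snd fp)).
apply/eK; exists (hpost N (cofree_unit M) f); apply: injective_projections.
  by apply: homsP => x; rewrite !hpostE cosyz_unit.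
by rewrite /= -fm.
Qed.

(** The cokernel is Ext^1(U, M), that is, the cokernel of the map from
    Hom(U, J M) to Hom(U, S M). *)
Lemma extK_unit_cokernel M :
  exists q : {linear E M -> quotm (limg (hpost N (cosyz_proj M)))},
    lepi q /\ lexact (extK_unit M) q.
Proof.
have [e [ee eK eU]] := extK_presentation M.
pose r : {linear homs N (cosyz M) -> quotm (limg (hpost N (cosyz_proj M)))} := qproj _.
have rex : lexact (hpost N (cosyz_proj M)) r by exact: qproj_exact.
pose w : {linear pullback M -> (homs N (cosyz M) * cofreem M)%type} := val.
have wB (p p' : pullback M) : val (p - p') = ((val p).1 - (val p').1, (val p).2 - (val p').2).
  exact (linearB w p p').
pose fstw : {linear pullback M -> homs N (cosyz M)} := lcomp fst w.
have [|q qP] := descend (g := lcomp r fstw) ee.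
  by move=> p /eK[f pf]; apply/rex; exists f; rewrite -[RHS]/(val p).1 pf.
exists q; split=> [y|z].
  have [g <-] := qproj_epi y; have [x xP] := cosyz_proj_epi (val g one).
  by exists (e (mkpullback (esym xP))); rewrite qP.
have mkE m : val (0 : homs N (cosyz M)) one = cosyz_proj M (cofree_unit M m).
  by rewrite cosyz_unit.
have jE m : e (mkpullback (mkE m)) = extK_unit M m by exact: eU.
have [p <-] := ee z; rewrite qP lcompE; split=> [/rex[f fp]|[m]].
  have /cosyz_exact[m mE] : cosyz_proj M ((val p).2 - val f one) = 0.
    rewrite linearB -pullback_prop; apply/eqP; rewrite subr_eq0; apply/eqP.
    exact: esym (congr1 (fun k => val k one) fp).
  have fE : val (hpost N (cosyz_proj M) f) one = cosyz_proj M (val f one) by [].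
  have ef0 : e (mkpullback fE) = 0 by apply/eK; exists f.
  have fst0 : (val p).1 - hpost N (cosyz_proj M) f = 0.
    by apply/eqP; rewrite subr_eq0; apply/eqP; exact: esym fp.
  exists m; rewrite -[e p]subr0 -ef0 -linearB; apply/esym/eU; rewrite wB.
  exact (congr2 pair fst0 (esym mE)).
rewrite -jE => /esym/eqP; rewrite -subr_eq0 -linearB => /eqP/eK[f].
rewrite wB => fp; apply/rex; exists f.
exact (etrans (esym (congr1 fst fp)) (subr0 (val p).1)).
Qed.

Hypothesis u_epi : ring_epimorphism u.

Lemma extK_unit_cokernel_ulocal M : cokernel_ulocal u (extK_unit M).
Proof.
have [q [qe qex]] := extK_unit_cokernel M.
exists (quotm (limg (hpost N (cosyz_proj M)))), q; split=> //.
apply: (ulocal_coker u_epi (@qproj_epi _ _ _) (@qproj_exact _ _ _ _)); exact: ulocal_homs.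
Qed.

Lemma extK_unit_kernel_ulocal M : ucospecial u M -> kernel_ulocal u (extK_unit M).
Proof.
move=> Mc; exists (homs N M), (heval u M); split; first exact: ulocal_homs.
  by move=> f f0; apply: Mc; rewrite -hevalE f0.
exact: extK_unit_kernel.
Qed.

Lemma extK_unit_bijective C : contramodule u C -> bijective (extK_unit C).
Proof.
move=> [C0 C1]; apply: bijective_lin => [c /extK_unit_kernel[f <-]|z].
  exact: (C0 (homlin f)).
have [q [qe qex]] := extK_unit_cokernel C; apply/qex.
have [g <-] := qproj_epi (q z); apply/qproj_exact.
have [h hP] := (ext1_projP _ _).1 C1 (homlin g).
by exists (@linhom R N _ h); apply: homsP.
Qed.

(** Ext^1(K, M) is the cokernel of Hom(U, J M) -> P, where P is the pullback. Maps
    to it from U and O U lift to P since Ext^1 and Ext^2 of U with values in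
    Hom(U, J M) vanish. A map U -> P takes its values in Hom(U, J M); a map
    O U -> P extends to F U, since Ext^1(U, Hom(U, S M)) = 0 and J M is
    injective. *)
Lemma extK_contramodule M :
  (forall X, ext1_proj RU (dual u X)) ->
  (forall X, ext1_proj (syz RU) (dual u X)) ->
  ucospecial u M -> contramodule u (E M).
Proof.
move=> ext1 ext2 Mc; have [e [ee eK eU]] := extK_presentation M.
pose w : {linear pullback M -> (homs N (cosyz M) * cofreem M)%type} := val.
have wm : lmono w by move=> p p0; apply: val_inj.
pose c := pair_map (hpost N (cosyz_proj M)) (heval u (cofreem M)).
have [|i iP] := corestrict (g := c) wm.
  move=> f; have fE : val (hpost N (cosyz_proj M) f) one = cosyz_proj M (val f one) by [].
  by exists (mkpullback fE).
have im : lmono i.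
  move=> f f0; have cf : c f = 0 by rewrite -iP f0 linear0.
  have [|h hP] := corestrict (g := homlin f) (@cofree_unit_mono _ M).
    by move=> x; apply/cosyz_exact; have := congr1 (fun p => val p.1 x) cf.
  have h0 : @linhom R N _ h = 0.
    apply: Mc; apply: (lmono_inj (@cofree_unit_mono _ M)).
    rewrite linear0; apply: etrans (hP one) _; exact: (congr1 snd cf).
  apply: homsP => x; apply: etrans (esym (hP x)) _.
  have -> : h x = 0 by exact: (congr1 (fun k => val k x) h0).
  by rewrite linear0.
have iex : lexact i e.
  move=> p; apply: iff_trans (eK p) _; split=> [[f fp]|[f <-]]; exists f.
    by apply: (lmono_inj wm); rewrite iP.
  exact: iP.
pose fw : {linear pullback M -> homs N (cosyz M)} := lcomp fst w.
pose sw : {linear pullback M -> cofreem M} := lcomp snd w.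
have fsw p : val (fw p) one = cosyz_proj M (sw p) by exact: pullback_prop.
split.
  move=> f x; have [h hP] := ext1_lift f (ext1 M) im ee iex.
  pose b := @linhom R N _ (lcomp sw h).
  rewrite -hP; apply/iex; exists (translate b x); apply: (lmono_inj wm).
  rewrite iP; apply: injective_projections; last by rewrite [LHS]hevalE translateE mul1r.
  apply: homsP => y; rewrite [LHS]hpostE translateE [RHS](hom_to_homs u_epi (lcomp fw h)).
  by rewrite -[y * x]mul1r -(hom_to_homs u_epi) lcompE fsw mul1r.
move=> f; have [h hP] := ext1_lift f (ext2 M) im ee iex.
have [al alP] := ext1_ulocal u_epi ext1 (ulocal_homs u (cosyz M)) (lcomp fw h).
have [be beP] := cofree_injective (lcomp sw h) (@syz_incl_mono _ RU).
(* The extensions al and be need not match in S M; their mismatch vanishes on O U,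
   and its transpose U -> Hom(U, S M) corrects al. *)
have [|de deP] := descend (e := free_cover RU)
    (g := lsub (lcomp (cosyz_proj M) be) (lcomp (heval u _) al)) (@free_cover_epi _ RU).
  by move=> _ /syz_exact[x <-]; rewrite lsubE !lcompE alP beP hevalE fsw subrr.
pose de' : {linear RU -> homs N (cosyz M)} := homlin (translatef (@linhom R N _ de)).
have de'E x : val (de' x) one = de x.
  by apply: etrans (translateE (@linhom R N _ de) x one) _; rewrite mul1r.
pose al' : {linear freem R RU -> homs N (cosyz M)} := al \+ lcomp de' (free_cover RU).
have al'E x : al' x = al x + de' (free_cover RU x) by [].
have [|h' h'P] := corestrict (g := pair_map al' be) wm.
  move=> x; suff xE : val (al' x) one = cosyz_proj M (be x) by exists (mkpullback xE).
  by rewrite al'E homsD de'E deP lsubE !lcompE hevalE addrC subrK.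
exists (lcomp e h') => x; rewrite lcompE -hP; congr (e _); apply: (lmono_inj wm).
rewrite h'P; apply: injective_projections; last exact: beP.
by rewrite [LHS]al'E syz_cover linear0 addr0 alP.
Qed.
End ExtK.

(** * The functor Tor_1(K, -) *)

#[local] Opaque tens freem syz.

Section TorK.
Variables (R U : pzRingType) (u : {rmorphism R -> U}).
Implicit Types A B C M : lmodType R.
Local Notation N := (Ubimod u).
Local Notation RU := (restr u).
Local Notation one := (1 : U).
Local Notation chains C := (tens N (freem R (syz C)) * tens (regbimod R) (freem R C))%type.

Section RegularTensor.
Variable A : lmodType R.
Lemma scale_Dl (r s : regbimod R) (a : A) : (r + s : R) *: a = (r : R) *: a + (s : R) *: a.
Proof. exact: scalerDl. Qed.
Lemma scale_Dr (r : regbimod R) (a b : A) : (r : R) *: (a + b) = (r : R) *: a + (r : R) *: b.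
Proof. exact: scalerDr. Qed.
Lemma scale_B (r : regbimod R) s (a : A) : (ract r s : R) *: a = (r : R) *: (s *: a).
Proof. exact: esym (scalerA _ _ _). Qed.
Lemma scale_Z s (r : regbimod R) (a : A) : (s *: r : R) *: a = s *: ((r : R) *: a).
Proof. exact: esym (scalerA _ _ _). Qed.

Definition tens_scale : {linear tens (regbimod R) A -> A} :=
  tens_lift scale_Dl scale_Dr scale_B scale_Z.

Lemma tens_scaleE r a : tens_scale (ptens (r : regbimod R) a) = (r : R) *: a.
Proof. exact: tens_lift_ptens. Qed.

Lemma tens_scaleK t : t = ptens (1 : regbimod R) (tens_scale t).
Proof.
have h_linear : linear (fun a : A => ptens (1 : regbimod R) a).
  move=> r a b; rewrite ptensDr -ptensB -ptensZ; congr (ptens _ a + _).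
  exact: etrans (mul1r r) (esym (mulr1 r)).
apply: (tens_linP (f := idfun) (g := lcomp (mklin h_linear) tens_scale)) => r a.
rewrite lcompE tens_scaleE; apply: etrans (ptensB (1 : regbimod R) r a).
by congr (ptens _ a); exact: esym (mul1r _).
Qed.

Lemma tens_scale_mono : lmono tens_scale.
Proof. by move=> t t0; rewrite [t]tens_scaleK t0 ptens0. Qed.
End RegularTensor.

Lemma tens_scale_natural A B (f : {linear A -> B}) t :
  tens_scale B (tpost (regbimod R) f t) = f (tens_scale A t).
Proof. by rewrite [t]tens_scaleK tpostE !tens_scaleE !scale1r. Qed.

Lemma tens_unit_map A t :
  tens_map (Kcomplex u) (idfun : {linear A -> A}) t = tens_unit u A (tens_scale A t).
Proof.
rewrite {1}[t]tens_scaleK tens_map_ptens tens_unitE; congr ptens.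
exact: rmorph1.
Qed.

Lemma tens_stepE X t : tpost N (free_step X) t =
  tpost N (syz_incl X) (tpost N (free_cover (syz X)) t).
Proof.
rewrite -lcompE; move: t; apply: tens_linP => x a; by rewrite lcompE !tpostE.
Qed.

Lemma tpost_unit A B (f : {linear A -> B}) a :
  tpost N f (tens_unit u A a) = tens_unit u B (f a).
Proof. exact: tpostE. Qed.

(** The differentials of K (x) F in degrees 2 and 1, for the free resolution F
    of C, with their sources and targets written out. *)
Definition ltens_d1 C : {linear chains (syz C) -> chains C} :=
  cone_step (tpost N (free_step (syz C))) (tens_map (Kcomplex u) idfun)
    (tpost (regbimod R) (free_step C)).

Definition ltens_d0 C : {linear chains C -> tens N (freem R C)} :=
  sum_map (tpost N (free_step C)) (tens_map (Kcomplex u) idfun).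

Definition torK1 C : lmodType R := homology (ltens_d1 C) (ltens_d0 C).

Local Notation cycle C := (subm (lker (ltens_d0 C))).
Local Notation bnd C := (boundary (ltens_d1 C) (ltens_d0 C)).

Lemma ltens_d0E C x : ltens_d0 C x =
  tpost N (free_step C) x.1 + tens_unit u _ (tens_scale _ x.2).
Proof. by rewrite -tens_unit_map. Qed.

Lemma ltens_d1E C x : ltens_d1 C x =
  (tpost N (free_step (syz C)) x.1 + tens_unit u _ (tens_scale _ x.2),
   - tpost (regbimod R) (free_step C) x.2).
Proof. by rewrite -tens_unit_map. Qed.

Definition cycle_val C : {linear cycle C -> chains C} := val.

Definition torK_cycle C : {linear cycle C -> C} :=
  lcomp (free_cover C) (lcomp (tens_scale _) (lcomp snd (@cycle_val C))).

Lemma torK1_counit_subproof C x : bnd C x -> torK_cycle C x = 0.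
Proof.
move=> [y yx].
have x2 := congr1 snd (etrans (esym yx) (ltens_d1E y)).
apply: etrans (congr1 (fun z => free_cover C (tens_scale _ z)) x2) _.
by rewrite !linearN tens_scale_natural free_stepE syz_cover oppr0.
Qed.

(** The map Tor_1(K, C) -> C is induced by the projection of K onto R[1]. *)
Definition torK1_counit C : {linear torK1 C -> C} := quotm_lift (@torK1_counit_subproof C).

Lemma torK1_counitE C x :
  torK1_counit C (qproj (bnd C) x) = free_cover C (tens_scale _ (val x).2).
Proof. exact: quotm_lift_qproj. Qed.

(** The same map on the value of the functor, which is torK1 C up to
    conversion. *)
Definition torK_counit C : {linear TorK (Kcomplex u) 1 C -> C} := torK1_counit C.

Lemma torK_counit_natural C (D : lmodType R) (f : {linear C -> D}) t :
  torK_counit D (fmap (TorK (Kcomplex u) 1) f t) = f (torK_counit C t).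
Proof.
pose dC n := chd (ltens (Kcomplex u) C) n; pose dD n := chd (ltens (Kcomplex u) D) n.
have fE (x : subm (lker (dC 0))) :
    fmap (TorK (Kcomplex u) 1) f (qproj (boundary (dC 1) (dC 0)) x) =
    qproj (boundary (dD 1) (dD 0))
      (cycle_map (@chmapd _ _ _ (ltens_map (Kcomplex u) f) 0) x).
  exact: (homology_map_qproj (@chmapd _ _ _ (ltens_map (Kcomplex u) f) 1)
    (@chmapd _ _ _ (ltens_map (Kcomplex u) f) 0) x).
have uE (x : subm (lker (dC 0))) :
    torK_counit C (qproj (boundary (dC 1) (dC 0)) x) =
    free_cover C (tens_scale _ (val x).2).
  exact: torK1_counitE.
move: t; apply: qprojW => x.
refine (etrans (congr1 (torK_counit D) (fE x)) _).
refine (etrans (torK1_counitE _) _).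
refine (etrans (congr1 (free_cover D) (tens_scale_natural (free_map f) (val x).2)) _).
refine (etrans (free_map_cover f _) _).
exact (congr1 f (esym (uE x))).
Qed.

Definition pushout_rel C : {linear syz C -> (tens N (syz C) * freem R C)%type} :=
  pair_map (tens_unit u (syz C)) (lsub (@lzero R _ _) (syz_incl C)).

Lemma pushout_relE C x :
  pushout_rel C x = (tens_unit u (syz C) x, - syz_incl C x).
Proof. by apply: injective_projections => //; exact: sub0r. Qed.

(** The pushout of U (x) O C <- O C -> F C. *)
Definition pushout C : lmodType R := quotm (limg (pushout_rel C)).

Definition mkpushout C : {linear (tens N (syz C) * freem R C)%type -> pushout C} :=
  qproj (limg (pushout_rel C)).

Lemma mkpushout_exact C : lexact (pushout_rel C) (mkpushout C).
Proof. exact: qproj_exact. Qed.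

Lemma mkpushout_epi C : lepi (mkpushout C).
Proof. exact: qproj_epi. Qed.

Definition pushout_sum C : {linear (tens N (syz C) * freem R C)%type -> tens N (freem R C)} :=
  sum_map (tpost N (syz_incl C)) (tens_unit u _).

Lemma pushout_sumE C x :
  pushout_sum C x = tpost N (syz_incl C) x.1 + tens_unit u _ x.2.
Proof. by []. Qed.

Lemma pushout_sum_subproof C x : limg (pushout_rel C) x -> pushout_sum C x = 0.
Proof.
by move=> [y <-]; rewrite pushout_relE pushout_sumE tpost_unit linearN subrr.
Qed.

Definition pushout_map C : {linear pushout C -> tens N (freem R C)} :=
  quotm_lift (@pushout_sum_subproof C).

Lemma pushout_mapE C x : pushout_map C (mkpushout C x) = pushout_sum C x.
Proof. exact: quotm_lift_qproj. Qed.

Lemma torK1_presentation C : exists i : {linear torK1 C -> pushout C},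
  [/\ lmono i, lexact i (pushout_map C) &
      forall t y z, i t = mkpushout C (y, z) -> torK1_counit C t = free_cover C z].
Proof.
pose v : {linear cycle C -> chains C} := val.
have vE (x : cycle C) : v x = val x by [].
pose m := prod_map (tpost N (free_cover (syz C))) (tens_scale (freem R C)).
have mE x : m x = (tpost N (free_cover (syz C)) x.1, tens_scale _ x.2) by [].
have d0m x : ltens_d0 C x = pushout_sum C (m x).
  by rewrite ltens_d0E pushout_sumE mE tens_stepE.
have qe : lepi (qproj (bnd C)) by exact: qproj_epi.
have q0 x : qproj (bnd C) x = 0 <-> exists y, ltens_d1 C y = val x.
  by rewrite -(linear0 (qproj (bnd C))); split=> [/quotmP|yx]; [|apply/quotmP]; rewrite subr0.
have [|i iP] := descend (g := lcomp (mkpushout C) (lcomp m v)) qe.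
  move=> x /q0[y yx]; rewrite !lcompE vE -yx ltens_d1E mE; apply/mkpushout_exact.
  exists (free_cover (syz C) (tens_scale _ y.2)); rewrite pushout_relE.
  rewrite linearN tens_scale_natural -free_stepE linearD tens_stepE tpost_unit.
  by rewrite (lexact_comp _ (@tens_cover_exact _ _ _)) add0r.
exists i; split.
- move=> t; have [x <-] := qe t; rewrite iP !lcompE => /mkpushout_exact[s].
  rewrite pushout_relE mE vE; case: (val x) (q0 x) => y z q0x yz.
  have ys : tpost N (free_cover (syz C)) y = tens_unit u _ s by exact: esym (congr1 fst yz).
  have zs : tens_scale _ z = - syz_incl C s by exact: esym (congr1 snd yz).
  apply/q0x; have [f fs] := free_cover_epi s.
  have /tens_cover_exact[w wP] : tpost N (free_cover (syz C)) (y - tens_unit u _ f) = 0.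
    by rewrite linearB tpost_unit fs ys subrr.
  have [w' w'P] := tens_cover_epi w.
  exists (w', ptens (1 : regbimod R) f); rewrite ltens_d1E tens_scaleE scale1r.
  rewrite tens_stepE w'P wP subrK; congr pair.
  apply: (lmono_inj (@tens_scale_mono _)); rewrite linearN tens_scale_natural.
  by rewrite tens_scaleE scale1r free_stepE fs.
- move=> x; have [[y z] <-] := mkpushout_epi x; rewrite pushout_mapE.
  split=> [yz|[t]]; last first.
    have [x' <-] := qe t; rewrite iP !lcompE => /(congr1 (pushout_map C)).
    by rewrite !pushout_mapE -d0m => <-; move: (valP x') => /asboolP.
  have [y' yy'] := tens_cover_epi y.
  pose c : chains C := (y', ptens (1 : regbimod R) z).
  have mc : m c = (y, z) by rewrite mE yy' tens_scaleE scale1r.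
  have Kc : smpred (lker (ltens_d0 C)) c by apply/asboolP; apply: etrans (d0m c) _; rewrite mc.
  exists (qproj (bnd C) (exist (fun x => smpred (lker (ltens_d0 C)) x) c Kc)).
  by rewrite iP !lcompE mc.
- move=> t y z; have [x <-] := qe t; rewrite iP torK1_counitE !lcompE mE => yz.
  have : mkpushout C ((tpost N (free_cover (syz C)) (v x).1, tens_scale _ (v x).2) - (y, z)) = 0.
    by rewrite linearB yz subrr.
  move/mkpushout_exact=> [s]; rewrite pushout_relE => /(congr1 snd) zs.
  apply/eqP; rewrite -subr_eq0; apply/eqP.
  apply: etrans (esym (linearB (free_cover C) _ _)) _.
  apply: etrans (congr1 (free_cover C) (esym zs)) _.
  by rewrite linearN syz_cover oppr0.
Qed.

(** The kernel is Tor_1(U, C), in the form of the kernel of the map from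
    U (x) O C to U (x) F C. *)
Lemma torK1_counit_kernel C :
  exists i : {linear subm (lker (tpost N (syz_incl C))) -> torK1 C},
    lmono i /\ lexact i (torK1_counit C).
Proof.
have [j [jm jex jc]] := torK1_presentation C.
pose v : {linear subm (lker (tpost N (syz_incl C))) -> tens N (syz C)} := val.
have v0 x : tpost N (syz_incl C) (v x) = 0 by move: (valP x) => /asboolP.
pose inl : {linear tens N (syz C) -> (tens N (syz C) * freem R C)%type} :=
  pair_map idfun (@lzero R _ _).
have inlE y : inl y = (y, 0) by [].
have [|i iP] := corestrict (g := lcomp (mkpushout C) (lcomp inl v)) jm.
  move=> x; apply/jex; rewrite !lcompE inlE pushout_mapE pushout_sumE.
  by rewrite v0 linear0 addr0.
exists i; split=> [x x0|t].
  have /mkpushout_exact[s] : mkpushout C (v x, 0) = 0 by rewrite -inlE -!lcompE -iP x0 linear0.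
  rewrite pushout_relE => sx.
  have s0 : s = 0.
    apply: syz_incl_mono; rewrite -[LHS]opprK; apply: etrans (congr1 -%R (congr1 snd sx)) _.
    exact: oppr0.
  apply: val_inj; apply: etrans (esym (congr1 fst sx)) _.
  by rewrite s0; exact: linear0.
have [[y z] yz] := mkpushout_epi (j t); have tz := jc t y z (esym yz).
split=> [t0|[x <-]]; last first.
  have xE : j (i x) = mkpushout C (v x, 0) by exact: iP.
  by rewrite (jc _ _ _ xE) linear0.
have /syz_exact[s sz] : free_cover C z = 0 by rewrite -tz.
pose y' := y + tens_unit u _ s.
have yE : j t = mkpushout C (y', 0).
  apply/eqP; rewrite -yz -subr_eq0 -linearB; apply/eqP/mkpushout_exact.
  exists (- s); rewrite pushout_relE !linearN opprK.
  apply: injective_projections; first by rewrite /= /y' opprD addNKr.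
  by rewrite /= subr0.
have y'0 : tpost N (syz_incl C) y' = 0.
  have := lexact_comp t jex; rewrite yE pushout_mapE pushout_sumE.
  by rewrite linear0 addr0.
have Ky : smpred (lker (tpost N (syz_incl C))) y' by apply/asboolP.
exists (exist (fun y => smpred (lker (tpost N (syz_incl C))) y) y' Ky).
by apply: (lmono_inj jm); rewrite iP yE.
Qed.

Lemma torK1_counit_exact C : lexact (torK1_counit C) (tens_unit u C).
Proof.
have [j [jm jex jc]] := torK1_presentation C.
move=> c; split=> [c0|[t <-]]; last first.
  have [[y z] yz] := mkpushout_epi (j t); rewrite (jc t y z (esym yz)).
  have := lexact_comp t jex; rewrite -yz pushout_mapE pushout_sumE.
  move/(congr1 (tpost N (free_cover C))); rewrite linear0 linearD tpost_unit.
  by rewrite (lexact_comp _ (@tens_cover_exact _ _ _)) add0r.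
have [f fc] := free_cover_epi c.
have /tens_cover_exact[y yf] : tpost N (free_cover C) (tens_unit u _ f) = 0.
  by rewrite tpost_unit fc c0.
have /jex[t tE] : pushout_map C (mkpushout C (- y, f)) = 0.
  by rewrite pushout_mapE pushout_sumE linearN yf addNr.
by exists t; rewrite (jc _ _ _ tE).
Qed.

Hypothesis u_epi : ring_epimorphism u.

Lemma torK_counit_kernel_ulocal C : kernel_ulocal u (torK_counit C).
Proof.
have [i [im iex]] := torK1_counit_kernel C.
exists (subm (lker (tpost N (syz_incl C)))), i; split=> //.
pose v : {linear subm (lker (tpost N (syz_incl C))) -> tens N (syz C)} := val.
apply: (@ulocal_ker _ _ _ u_epi _ _ _ v (tpost N (syz_incl C))).
- by move=> x x0; apply: val_inj.
- move=> y; split=> [y0|[x <-]]; last by move: (valP x) => /asboolP.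
  have Ky : smpred (lker (tpost N (syz_incl C))) y by apply/asboolP.
  by exists (exist (fun y => smpred (lker (tpost N (syz_incl C))) y) y Ky).
- exact: ulocal_tens.
- exact: ulocal_tens.
Qed.

Lemma torK_counit_cokernel_ulocal C : uspecial u C -> cokernel_ulocal u (torK_counit C).
Proof.
move=> Cs; exists (tens N C), (tens_unit u C); split=> //; first exact: ulocal_tens.
exact: torK1_counit_exact.
Qed.

Lemma torK1_counit_bijective M : comodule u M -> bijective (torK1_counit M).
Proof.
move=> /ucomoduleP[t0 /Tor1P t1]; have [i [im iex]] := torK1_counit_kernel M.
apply: bijective_lin => [t /iex[x <-]|m].
  suff -> : x = 0 by rewrite linear0.
  by apply: val_inj; apply: t1; move: (valP x) => /asboolP.
by apply/torK1_counit_exact; apply: t0.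
Qed.

Lemma torK_counit_bijective M : comodule u M -> bijective (torK_counit M).
Proof. exact (@torK1_counit_bijective M). Qed.

Hypothesis ext1 : forall X, ext1_proj RU (dual u X).
Hypothesis ext2 : forall X, ext1_proj (syz RU) (dual u X).

(** Tor_1(K, C) is the kernel of Q -> U (x) F C, where Q is the pushout. Maps from
    it to V = Hom(U, J) and to S V extend to Q, since Ext^1(U, V) = 0 = Ext^2(U, V)
    and F C is free. A map Q -> V factors through U (x) F C; a map Q -> S V lifts
    to J V, since Ext^1(U (x) O C, V) = 0 and F C is free. *)
Lemma torK1_comodule C : uspecial u C -> comodule u (torK1 C).
Proof.
move=> Cs; have [j [jm jex _]] := torK1_presentation C.
have te : lepi (pushout_map C).
  move=> z; have [c cz] := Cs (tpost N (free_cover C) z).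
  have [f fc] := free_cover_epi c.
  have /tens_cover_exact[y yz] : tpost N (free_cover C) (z - tens_unit u _ f) = 0.
    by rewrite linearB tpost_unit fc [tens_unit u C c]cz subrr.
  by exists (mkpushout C (y, f)); rewrite pushout_mapE pushout_sumE yz subrK.
pose inl : {linear tens N (syz C) -> (tens N (syz C) * freem R C)%type} :=
  pair_map idfun (@lzero R _ _).
pose inr : {linear freem R C -> (tens N (syz C) * freem R C)%type} :=
  pair_map (@lzero R _ _) idfun.
have splitE (Y : lmodType R) (h : {linear pushout C -> Y}) y z :
    h (mkpushout C (y, z)) =
    lcomp h (lcomp (mkpushout C) inl) y + lcomp h (lcomp (mkpushout C) inr) z.
  rewrite !lcompE -!linearD; congr (h (mkpushout C _)).
  by apply: injective_projections; rewrite /= ?addr0 ?add0r.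
have relE (Y : lmodType R) (h : {linear pushout C -> Y}) s :
    lcomp h (lcomp (mkpushout C) inl) (tens_unit u _ s) =
    lcomp h (lcomp (mkpushout C) inr) (syz_incl C s).
  apply/eqP; rewrite -subr_eq0 -linearN -splitE -pushout_relE.
  by rewrite (lexact_comp _ (@mkpushout_exact C)) linear0.
split=> X; set V := dual u X.
  move=> g t; have Vl : ulocal u V by exact: ulocal_homs.
  have [|h hP] := ext1_extend (A := tens N (freem R C)) g _ jm te jex.
    by apply: ext1_tens_free; apply/ext1_projP; exact: ext1.
  pose a := lcomp h (lcomp (mkpushout C) inl).
  pose b := lcomp h (lcomp (mkpushout C) inr).
  have [b' b'P] := ulocal_extend b Vl.
  have aE : a =1 lcomp b' (tpost N (syz_incl C)).
    apply: (tens_ulocal_ext u_epi) => // s.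
    by rewrite lcompE tpost_unit b'P; exact: relE.
  have [[y z] yz] := mkpushout_epi (j t).
  rewrite -hP -yz splitE [lcomp _ _ y]aE -[lcomp _ _ z]b'P lcompE -linearD.
  rewrite -(pushout_sumE (y, z)) -pushout_mapE yz (lexact_comp _ jex).
  exact: linear0.
apply/ext1_projP => g.
have Vl : ulocal u V by exact: ulocal_homs.
have [|h hP] := ext1_extend (A := tens N (freem R C)) g _ jm te jex.
  by apply: ext1_tens_free; apply/ext1_projP/ext1_shift; exact: ext2.
pose a := lcomp h (lcomp (mkpushout C) inl).
pose b := lcomp h (lcomp (mkpushout C) inr).
have [be beP] := free_projective b (@cosyz_proj_epi _ V).
have [al alP] := ext1_ulocal_dual u_epi ext1 (ulocal_tens u (syz C)) a.
(* The lifts al and be need not match on O C; their mismatch O C -> V extends to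
   U (x) O C, which corrects al. *)
have [|d dP] := corestrict (g := lsub (lcomp al (tens_unit u _)) (lcomp be (syz_incl C)))
    (@cofree_unit_mono _ V).
  move=> s; apply/cosyz_exact; rewrite lsubE linearB !lcompE alP beP.
  by apply/eqP; rewrite subr_eq0; apply/eqP; exact: relE.
have [d' d'P] := ulocal_extend d Vl.
have [|H HP] := descend (e := mkpushout C)
    (g := sum_map (lsub al (lcomp (cofree_unit V) d')) be) (@mkpushout_epi C).
  move=> _ /mkpushout_exact[s <-]; rewrite pushout_relE.
  rewrite -[LHS]/(lsub al (lcomp (cofree_unit V) d') (tens_unit u _ s) + be (- syz_incl C s)).
  by rewrite lsubE lcompE d'P dP lsubE !lcompE linearN opprB addrCA subrr addr0 subrr.
exists (lcomp H j) => t; have [[y z] yz] := mkpushout_epi (j t).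
rewrite lcompE -hP -yz HP splitE.
rewrite -[sum_map _ _ _]/(lsub al (lcomp (cofree_unit V) d') y + be z).
by rewrite linearD beP lsubE linearB lcompE cosyz_unit subr0 alP.
Qed.

Lemma torK_comodule C : uspecial u C -> comodule u (TorK (Kcomplex u) 1 C).
Proof. exact (@torK1_comodule C). Qed.
End TorK.

(** * The equivalence *)

#[local] Opaque TorK ExtK torK_counit extK_unit lcomp.

Definition linv (R : pzRingType) (A B : lmodType R) (f : {linear A -> B})
    (f_bij : bijective f) : {linear B -> A} :=
  projT1 (cid (linear_inverse f_bij)).

Lemma linvK (R : pzRingType) (A B : lmodType R) (f : {linear A -> B})
  (f_bij : bijective f) : cancel f (linv f_bij).
Proof. by rewrite /linv; case: cid => h []. Qed.

Lemma linvKV (R : pzRingType) (A B : lmodType R) (f : {linear A -> B})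
  (f_bij : bijective f) : cancel (linv f_bij) f.
Proof. by rewrite /linv; case: cid => h []. Qed.

Lemma linv_bij (R : pzRingType) (A B : lmodType R) (f : {linear A -> B})
  (f_bij : bijective f) : bijective (linv f_bij).
Proof. by exists f; [exact: linvKV | exact: linvK]. Qed.

Section Equivalence.
Variables (R U : pzRingType) (u : {rmorphism R -> U}).
Hypothesis u_epi : ring_epimorphism u.
Hypothesis tor1 : is_zero (Tor (Ubimod u) 1 (restr u)).
Hypothesis tor2 : is_zero (Tor (Ubimod u) 2 (restr u)).
Local Notation T := (TorK (Kcomplex u) 1).
Local Notation E := (ExtK (Kcomplex u) 1).
Implicit Types (M C : lmodType R).

Lemma ext1_dual X : ext1_proj (restr u) (dual u X).
Proof. exact ((Tor1_zeroP (Ubimod u) (restr u)).1 ((Tor1P (Ubimod u) (restr u)).1 tor1) X). Qed.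

Lemma ext2_dual X : ext1_proj (syz (restr u)) (dual u X).
Proof.
exact ((Tor1_zeroP (Ubimod u) (syz (restr u))).1
  ((Tor2P (Ubimod u) (restr u)).1 tor2) X).
Qed.

Lemma extK_special_contramodule M : ucospecial u M /\ ucomodule u M ->
  uspecial u (E M) /\ ucontramodule u (E M).
Proof.
move=> [Mc /ucomoduleP Mu]; split.
  exact: uspecial_of_cokernel (extK_unit_cokernel_ulocal u_epi M).
by apply/ucontramoduleP; exact: extK_contramodule ext1_dual ext2_dual Mc.
Qed.

Lemma torK_cospecial_comodule C : uspecial u C /\ ucontramodule u C ->
  ucospecial u (T C) /\ ucomodule u (T C).
Proof.
move=> [Cs /ucontramoduleP Cu]; split.
  exact: ucospecial_of_kernel (torK_counit_kernel_ulocal u_epi C).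
by apply/ucomoduleP; exact: torK_comodule ext1_dual ext2_dual _ Cs.
Qed.

Section Unit.
Variables (M : lmodType R) (pM : ucospecial u M /\ ucomodule u M).

(** The lift of M -> Ext^1(K, M) along Tor_1(K, Ext^1(K, M)) -> Ext^1(K, M). *)
Definition comodule_unit : {linear M -> T (E M)} :=
  lcomp (fmap T (extK_unit u M))
    (linv (torK_counit_bijective ((ucomoduleP u M).1 pM.2))).

Lemma comodule_unitE t :
  comodule_unit (torK_counit u M t) = fmap T (extK_unit u M) t.
Proof. by rewrite lcompE linvK. Qed.

Lemma comodule_unit_bij : bijective comodule_unit.
Proof.
have [Mc /ucomoduleP Mu] := pM.
have [Es _] := extK_special_contramodule pM.
have pE : lcomp (torK_counit u (E M)) comodule_unit = extK_unit u M.
  apply: lin_ext => m.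
  rewrite (lcompE (torK_counit u (E M)) comodule_unit m).
  rewrite (lcompE (fmap T (extK_unit u M)) _ m).
  rewrite torK_counit_natural.
  by rewrite linvKV.
apply: (comodule_bijective u_epi (p := torK_counit u (E M)) Mu).
- exact: torK_comodule ext1_dual ext2_dual _ Es.
- exact: torK_counit_kernel_ulocal.
- by rewrite pE; exact: extK_unit_kernel_ulocal.
- by rewrite pE; exact: extK_unit_cokernel_ulocal.
Qed.
End Unit.

Section Counit.
Variables (C : lmodType R) (pC : uspecial u C /\ ucontramodule u C).

Let j_bij := extK_unit_bijective ((ucontramoduleP u C).1 pC.2).

(** The extension of Tor_1(K, C) -> C along the map from Tor_1(K, C) to
    Ext^1(K, Tor_1(K, C)). *)
Definition contramodule_counit : {linear E (T C) -> C} :=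
  lcomp (linv j_bij) (fmap E (torK_counit u C)).

Lemma contramodule_counitE z :
  extK_unit u C (contramodule_counit z) = fmap E (torK_counit u C) z.
Proof. by rewrite lcompE linvKV. Qed.

Lemma contramodule_counit_bij : bijective contramodule_counit.
Proof.
have [Cs /ucontramoduleP Cu] := pC.
have [Tc _] := torK_cospecial_comodule pC.
have jT : lcomp contramodule_counit (extK_unit u (T C)) = torK_counit u C.
  apply: lin_ext => t; apply: (bij_inj j_bij).
  by rewrite lcompE contramodule_counitE -extK_unit_natural.
apply: (contramodule_bijective u_epi (j := extK_unit u (T C)) _ Cu).
- exact: extK_contramodule ext1_dual ext2_dual Tc.
- exact: extK_unit_cokernel_ulocal.
- by rewrite jT; exact: torK_counit_kernel_ulocal.
- by rewrite jT; exact: torK_counit_cokernel_ulocal.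
Qed.
End Counit.

Lemma comodule_unit_natural M M' pM pM' (f : {linear M -> M'}) m :
  comodule_unit pM' (f m) = fmap (fcompose T E) f (comodule_unit (M := M) pM m).
Proof.
have p_bij := torK_counit_bijective ((ucomoduleP u M).1 pM.2).
rewrite -(linvKV p_bij m); set t := linv _ m.
refine (etrans (congr1 (comodule_unit pM') (esym (torK_counit_natural f t))) _).
refine (etrans (comodule_unitE pM' _) _).
refine (etrans _ (congr1 (fmap (fcompose T E) f) (esym (comodule_unitE pM t)))).
refine (etrans (esym (fmap_comp (extK_unit u M') f t)) _).
refine (etrans _ (fmap_comp (fmap E f) (extK_unit u M) t)).
by congr (fmap T _ t); apply: lin_ext => x; exact: extK_unit_natural.
Qed.

Lemma contramodule_counit_natural C C' pC pC' (f : {linear C -> C'}) z :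
  contramodule_counit pC' (fmap (fcompose E T) f z) =
  f (contramodule_counit (C := C) pC z).
Proof.
apply: (bij_inj (extK_unit_bijective ((ucontramoduleP u C').1 pC'.2))).
refine (etrans (contramodule_counitE pC' _) _).
refine (etrans _ (esym (extK_unit_natural u f _))).
refine (etrans _ (congr1 (fmap E f) (esym (contramodule_counitE pC z)))).
refine (etrans (esym (fmap_comp (torK_counit u C') (fmap T f) z)) _).
refine (etrans _ (fmap_comp f (torK_counit u C) z)).
refine (congr1 (fun g => fmap E g z) (_ : _ = _)).
by apply: lin_ext => x; exact (torK_counit_natural f x).
Qed.
End Equivalence.

Theorem theorem2p3 (R U : pzRingType) (u : {rmorphism R -> U})
    (u_epi : ring_epimorphism u)
    (tor1 : is_zero (Tor (Ubimod u) 1 (restr u)))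
    (tor2 : is_zero (Tor (Ubimod u) 2 (restr u))) :
  mutually_inverse_equivalences
    (fun M : lmodType R => ucospecial u M /\ ucomodule u M)
    (fun C : lmodType R => uspecial u C /\ ucontramodule u C)
    (ExtK (Kcomplex u) 1)
    (TorK (Kcomplex u) 1).
Proof.
split.
- exact: extK_special_contramodule.
- exact: torK_cospecial_comodule.
- exists (@comodule_unit R U u); split=> [M pM|M N pM pN f x].
    exact (comodule_unit_bij u_epi tor1 tor2 pM).
  exact (comodule_unit_natural pM pN f x).
- pose counit_bij C pC := @contramodule_counit_bij R U u u_epi tor1 tor2 C pC.
  exists (fun C pC => linv (counit_bij C pC)).
  split=> [C pC|C D pC pD f x]; first exact: linv_bij.
  apply (bij_inj (counit_bij D pD)).
  refine (etrans (linvKV (counit_bij D pD) _) _).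
  refine (etrans _ (esym (contramodule_counit_natural pC pD f _))).
  exact (congr1 f (esym (linvKV (counit_bij C pC) x))).
Qed.
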